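(* Let $V$ be a real separable Banach space with dual $V'$, and let $\mathcal{A}:D(\mathcal{A})\to 2^{V}$ be a densely defined m-accretive operator whose associated semigroup $T_{\mathcal{A}}$ is domain invariant and admits an infinitesimal generator $\mathcal{A}^{\circ}:V\to V$. Let $\mathcal{V}\subseteq V$ be a linear subspace and let $V^{\ast}\subseteq V'$ be a subset which separates points. Let $x\in\mathcal{M}(\Omega;V)$, $\eta\in\mathcal{M}((0,\infty)\times Z\times\Omega;V)$ and let $\mathbb{X}$ denote the process generated by $(x,\eta)$. Assume that $x\in\mathcal{V}$ almost surely and that, with probability one, $\eta(t,z)\in\mathcal{V}$ for all $t\in(0,\infty)$ and $z\in Z$. Finally, assume that $\mathcal{V}$ is invariant w.r.t. $T_{\mathcal{A}}$ and that $\langle\Psi,\mathcal{A}^{\circ}T_{\mathcal{A}}(\cdot)u\rangle_{V}\in L^{1}((0,t))$ for all $t>0$, $u\in\mathcal{V}$ and $\Psi\in V^{\ast}$. Then $\mathbb{X}$ is the unique (up to indistinguishability) strong solution of (ACPRM)$\{x,\eta,V^{\ast}\}$.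
   Context: **Point processes.** $(\Omega,\mathcal{F},\mathbb{P})$ is a complete probability space and $(Z,\mathcal{Z})$ a measurable space; $\mathfrak{B}(\cdot)$ denotes Borel $\sigma$-algebras. A point function is a map $\theta:D(\theta)\to Z$ with $D(\theta)\subseteq(0,\infty)$ countable; $\pi(Z)$ is the set of all point functions, with the $\sigma$-algebra $\Pi(Z)$ generated by the sets $\{\theta\in\pi(Z):\#\{t\in D(\theta):(t,\theta(t))\in U\}=k\}$, $k\in\mathbb{N}_{0}$, $U\in\mathfrak{B}((0,\infty))\otimes\mathcal{Z}$. A point process is an $\mathcal{F}$-$\Pi(Z)$-measurable map $\Theta:\Omega\to\pi(Z)$; its counting measure is $N_{\Theta}(U,\omega)=\#\{t\in D(\Theta(\omega)):(t,\Theta(\omega)(t))\in U\}$. $\Theta$ is finite if $\mathbb{E}N_{\Theta}((0,t]\times Z)<\infty$ for all $t>0$. A finite point process $\Theta$, with $D(\Theta(\omega))$ infinite for a.e. $\omega$, is fixed. Its hitting times are the a.s. unique measurable $\alpha_{m}:\Omega\to(0,\infty)$, $m\in\mathbb{N}$, with, almost surely, $D(\Theta)=\{\alpha_{1},\alpha_{2},\dots\}$ and $0<\alpha_{1}<\alpha_{2}<\cdots$ (then $\alpha_{m}\to\infty$ a.s.); $\alpha_{0}:=0$. Integrals against $N_{\Theta}$ are pathwise (for a.e. $\omega$) Lebesgue integrals w.r.t. $N_{\Theta}(\cdot,\omega)$. **Function spaces.** $\mathcal{M}(\Omega;V)$ is the set of $\mathcal{F}$-$\mathfrak{B}(V)$-measurable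 maps $\Omega\to V$; $\mathcal{M}((0,\infty)\times Z\times\Omega;V)$ is the set of $\mathfrak{B}((0,\infty))\otimes\mathcal{Z}\otimes\mathcal{F}$-$\mathfrak{B}(V)$-measurable maps. $\langle\cdot,\cdot\rangle_{V}$ is the duality between $V$ and $V'$. $V^{\ast}\subseteq V'$ separates points if $\langle\Phi,v\rangle_{V}=0$ for all $\Phi\in V^{\ast}$ implies $v=0$. $W^{1,1}([a,b];V)$ is the set of $f:[a,b]\to V$ that are absolutely continuous and differentiable a.e. **Operators and semigroups.** A multi-valued operator $\mathcal{A}:V\to 2^{V}$ has $D(\mathcal{A})=\{v:\mathcal{A}v\ne\emptyset\}$ and is identified with its graph $\{(v,\hat v):\hat v\in\mathcal{A}v\}$. It is accretive if $\|v_1-v_2\|_V\le\|v_1-v_2+\alpha(\hat v_1-\hat v_2)\|_V$ for all $\alpha>0$, $(v_i,\hat v_i)\in\mathcal{A}$; m-accretive if moreover $R(\mathrm{Id}+\alpha\mathcal{A})=V$ for all $\alpha>0$; densely defined if $\overline{D(\mathcal{A})}=V$. For $\mathcal{A}$ m-accretive and densely defined, $T_{\mathcal{A}}(\cdot)v:[0,\infty)\to V$ is the unique mild solution (in the usual sense of nonlinear semigroup theory, i.e. limit of implicit Euler schemes; equivalently $T_{\mathcal{A}}(t)v=\lim_{n}(\mathrm{Id}+\frac{t}{n}\mathcal{A})^{-n}v$) of $0\in u'(t)+\mathcal{A}u(t)$, $u(0)=v$; $(T_{\mathcal{A}}(t))_{t\ge0}$ is the semigroup associated to $\mathcal{A}$.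 A set $\tilde V\subseteq V$ is invariant w.r.t. $T_{\mathcal{A}}$ if $T_{\mathcal{A}}(t)\tilde v\in\tilde V$ for all $t\ge0$, $\tilde v\in\tilde V$. $T_{\mathcal{A}}$ is domain invariant if $T_{\mathcal{A}}(t)v\in D(\mathcal{A})$ for all $t>0$, $v\in V$. $T_{\mathcal{A}}$ admits the infinitesimal generator $\mathcal{A}^{\circ}:V\to V$ if $-\lim_{h\searrow0}\frac{T_{\mathcal{A}}(h)v-v}{h}=\mathcal{A}^{\circ}v\in\mathcal{A}v$ for all $v\in D(\mathcal{A})$, and $\mathcal{A}^{\circ}v=0$ for $v\notin D(\mathcal{A})$. **Strong solutions.** (ACPRM) is the formal inclusion $\eta(t,z)N_{\Theta}(dt\otimes z)\in dX(t)+\mathcal{A}X(t)dt$. A $\mathfrak{B}([0,\infty))\otimes\mathcal{F}$-$\mathfrak{B}(V)$-measurable process $X:[0,\infty)\times\Omega\to V$ is a strong solution of (ACPRM)$\{x,\eta,V^{\ast}\}$ if for $\mathbb{P}$-a.e. $\omega$: (i) $X(0,\omega)=x(\omega)$; (ii) $t\mapsto X(t,\omega)$ is càdlàg; (iii) $X(t,\omega)\in D(\mathcal{A})$ for all $t\in(0,\infty)\setminus\{\alpha_m(\omega):m\in\mathbb{N}\}$; (iv) for all $m\in\mathbb{N}_0$ and $[a,b]\subseteq(\alpha_m(\omega),\alpha_{m+1}(\omega))$, $X(\cdot,\omega)|_{[a,b]}\in W^{1,1}([a,b];V)$; (v) $\langle\Psi,\mathcal{A}^{\circ}X(\cdot,\omega)\rangle_V\in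 L^1(0,t)$ for all $t>0$, $\Psi\in V^{\ast}$; (vi) $\langle\Psi,X(t,\omega)-x(\omega)\rangle_V+\int_0^t\langle\Psi,\mathcal{A}^{\circ}X(\tau,\omega)\rangle_Vd\tau=\int_{(0,t]\times Z}\langle\Psi,\eta(\tau,z,\omega)\rangle_VN_{\Theta}(d\tau\otimes z,\omega)$ for all $t>0$, $\Psi\in V^{\ast}$. **Process generated by $(x,\eta)$.** Put $\eta_m(\omega):=\eta(\alpha_m(\omega),\Theta(\omega)(\alpha_m(\omega)),\omega)$ for $m\in\mathbb N$, $\mathsf{x}_0:=x$, $\mathsf{x}_m:=T_{\mathcal{A}}(\alpha_m-\alpha_{m-1})\mathsf{x}_{m-1}+\eta_m$ for $m\in\mathbb{N}$, and $\mathbb{X}(t):=\sum_{m=0}^{\infty}T_{\mathcal{A}}((t-\alpha_m)_+)(\mathsf{x}_m)\mathbf{1}_{[\alpha_m,\alpha_{m+1})}(t)$, $t\ge0$. Everything is defined up to $\mathbb{P}$-null sets, and indistinguishable processes are identified. *)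

(* Defs.v *)
From HB Require Import structures.
From mathcomp Require Import all_boot all_order all_algebra.
From mathcomp Require Import all_classical all_reals all_analysis.
Set Implicit Arguments.
Unset Strict Implicit.
Unset Printing Implicit Defensive.
Import Order.TTheory GRing.Theory Num.Theory.
Import numFieldNormedType.Exports.
Local Open Scope classical_set_scope.
Local Open Scope ring_scope.

Notation borelType V := (g_sigma_algebraType (@open V)).

Definition separable (V : topologicalType) :=
  exists2 D : set V, countable D & dense D.

Section dual.
Context {R : realType} {V : normedModType R}.

Definition topological_dual : set {linear V -> R^o} :=
  [set Psi | continuous Psi].

Definition separates_points (Vstar : set {linear V -> R^o}) :=
  forall v : V, (forall Psi, Vstar Psi -> Psi v = 0) -> v = 0.

End dual.

Section absolute_continuity.
Context {R : realType} {V : normedModType R}.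

Definition absolutely_continuous_on (a b : R) (f : R -> V) :=
  forall e : R, 0 < e -> exists2 d : R, 0 < d &
    forall (n : nat) (l r : 'I_n -> R),
      (forall i, a <= l i /\ l i <= r i /\ r i <= b) ->
      (forall i j, i != j -> r i <= l j \/ r j <= l i) ->
      \sum_(i < n) (r i - l i) < d ->
      \sum_(i < n) `|f (r i) - f (l i)| < e.

Definition W11 (a b : R) (f : R -> V) :=
  absolutely_continuous_on a b f /\
  {ae (@lebesgue_measure R), forall t, t \in `]a, b[ ->
    derivable (f : R^o -> V) t 1}.

Definition cadlag (f : R -> V) :=
  (forall t : R, 0 <= t -> f s @[s --> t^'+] --> f t) /\
  (forall t : R, 0 < t -> cvg (f s @[s --> t^'-])).

End absolute_continuity.

Section operators.
Context {R : realType} {V : normedModType R}.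
Implicit Types (A : V -> set V) (T : R -> V -> V).

Definition op_domain A : set V := [set v | A v !=set0].

Definition accretive A :=
  forall (a : R) v1 w1 v2 w2, 0 < a -> A v1 w1 -> A v2 w2 ->
    `|v1 - v2| <= `|v1 - v2 + a *: (w1 - w2)|.

Definition m_accretive A :=
  accretive A /\
  forall a : R, 0 < a -> forall y, exists v w, A v w /\ v + a *: w = y.

Definition densely_defined A := closure (op_domain A) = setT.

(* Implicit Euler scheme of accuracy [e] on [[0, S]] for [0 \in u' + A u]:
   nodes [t 0 < ... < t n], values [v i] at the nodes, errors [f i], and
   [f (i+1) \in (v (i+1) - v i) / (t (i+1) - t i) + A (v (i+1))]. *)
Definition euler_scheme A (S e : R) (n : nat) (t : nat -> R) (v f : nat -> V) :=
  [/\ t 0%N = 0,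
      forall i, (i < n)%N -> 0 < t i.+1 - t i /\ t i.+1 - t i <= e,
      S - e < t n /\ t n <= S,
      forall i, (i < n)%N ->
        A (v i.+1) (f i.+1 - (t i.+1 - t i)^-1 *: (v i.+1 - v i)) &
      \sum_(i < n) (t i.+1 - t i) * `|f i.+1| <= e].

(* [u] is a mild solution of [0 \in u' + A u] on [[0, +oo[] with [u 0 = v0]:
   a continuous function that is, on every [[0, S]], the uniform limit of the
   step functions defined by Euler schemes of vanishing accuracy. *)
Definition mild_solution A (v0 : V) (u : R -> V) :=
  [/\ {within `[0, +oo[, continuous u},
      u 0 = v0 &
      forall S e : R, 0 < S -> 0 < e -> exists n t v f,
        [/\ euler_scheme A S e n t v f,
            `|u 0 - v 0%N| <= e &
            forall i s, (i < n)%N -> s \in `]t i, t i.+1] ->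
              `|u s - v i.+1| <= e]].

(* The values of [T] at negative times are irrelevant. *)
Definition associated_semigroup A T := forall v, mild_solution A v (T ^~ v).

Definition semigroup_invariant T (U : set V) :=
  forall t u, 0 <= t -> U u -> U (T t u).

Definition domain_invariant A T := forall t v, 0 < t -> op_domain A (T t v).

Definition infinitesimal_generator A T (A0 : V -> V) :=
  (forall v, op_domain A v ->
    - (h^-1 *: (T h v - v)) @[h --> 0^'+] --> A0 v /\ A v (A0 v)) /\
  (forall v, ~ op_domain A v -> A0 v = 0).

End operators.

(* A partial map: [point_fun t = None] off the domain. *)
Record point_function (R : realType) (Z : Type) := PointFunction {
  point_fun :> R -> option Z ;
  point_fun_countable : countable [set t | isSome (point_fun t)] ;
  point_fun_gt0 : [set t | isSome (point_fun t)] `<=` `]0, +oo[ }.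

Section point_function.
Context {R : realType} {d : measure_display} {Z : measurableType d}.
Local Notation point_function := (point_function R Z).
Implicit Types (theta : point_function) (U : set (measurableTypeR R * Z)).

Definition point_dom theta : set R := [set t | isSome (theta t)].

Definition hits theta U : set R :=
  [set t | exists2 z, theta t = Some z & U (t, z)].

Lemma point_function0_subproof :
  countable [set t : R | isSome (@None Z)] /\
  [set t : R | isSome (@None Z)] `<=` `]0, +oo[.
Proof.
have -> : [set t : R | isSome (@None Z)] = set0 by apply/seteqP; split.
by split => //; exact: countable0.
Qed.

Definition point_function0 : point_function :=
  @PointFunction R Z (fun=> None) point_function0_subproof.1
    point_function0_subproof.2.

HB.instance Definition _ := gen_eqMixin point_function.
HB.instance Definition _ := gen_choiceMixin point_function.
HB.instance Definition _ := isPointed.Build point_function point_function0.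

Definition point_function_generators : set (set point_function) :=
  [set G | exists k U, measurable U /\ G = [set theta | (hits theta U #= `I_k)%card]].

Definition counting_measure theta U : \bar R := counting (hits theta U).

Lemma countable_hits theta U : countable (hits theta U).
Proof.
apply: sub_countable (point_fun_countable theta); apply: subset_card_le.
by move=> t [z /= -> _].
Qed.

Let counting_measure0 theta : counting_measure theta set0 = 0%E.
Proof.
rewrite /counting_measure (_ : hits theta set0 = set0).
  exact: (measure0 (@counting (measurableTypeR R) R)).
by apply/seteqP; split => t // [].
Qed.

Let counting_measure_ge0 theta U : (0 <= counting_measure theta U)%E.
Proof. exact: (measure_ge0 (@counting (measurableTypeR R) R)). Qed.

Let counting_measure_sigma_additive theta :
  semi_sigma_additive (counting_measure theta).
Proof.
move=> F mF tF mU; rewrite /counting_measure.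
have mh U : measurable (hits theta U : set (measurableTypeR R)).
  apply: countable_measurable; last exact: countable_hits.
  by move=> t; exact: measurable_set1.
have -> : hits theta (\bigcup_n F n) = \bigcup_n hits theta (F n).
  apply/seteqP; split => t.
    by move=> [z tz [n _ Fn]]; exists n => //; exists z.
  by move=> [n _ [z tz Fn]]; exists z => //; exists n.
apply: (@measure_semi_sigma_additive _ (measurableTypeR R) R counting).
- by move=> n; exact: mh.
- move=> i j _ _ [t [[z tz Fi] [z' tz' Fj]]]; apply: tF => //.
  by move: tz' Fj; rewrite tz => -[<-] Fj; exists (t, z).
- by apply: bigcup_measurable => n _; exact: mh.
Qed.

HB.instance Definition _ theta := isMeasure.Build _ _ _
  (counting_measure theta) (counting_measure0 theta)
  (counting_measure_ge0 theta) (@counting_measure_sigma_additive theta).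

End point_function.

Section point_process.
Context {R : realType} {d d' : measure_display} {Omega : measurableType d}.
Context (P : probability Omega R) {Z : measurableType d'}.
Implicit Types (Theta : Omega -> point_function R Z) (alpha : nat -> Omega -> R).

Definition point_process Theta :=
  measurable_fun setT
    (Theta : Omega -> g_sigma_algebraType (@point_function_generators R d' Z)).

Definition finite_point_process Theta :=
  point_process Theta /\
  forall t : R, 0 < t ->
    (\int[P]_w counting_measure (Theta w) (`]0%R, t] `*` [set: Z]) < +oo)%E.

(* [alpha m.+1] is the (m+1)-th hitting time; [alpha 0] is the constant 0. *)
Definition hitting_times Theta alpha :=
  [/\ forall w, alpha 0%N w = 0,
      forall m, measurable_fun setT (alpha m),
      forall m w, 0 < alpha m.+1 w &
      {ae P, forall w,
        point_dom (Theta w) = range (fun m => alpha m.+1 w) /\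
        forall m, alpha m w < alpha m.+1 w}].

End point_process.

Section ACPRM.
Context {R : realType} {d d' : measure_display} {Omega : measurableType d}.
Context (P : probability Omega R) {Z : measurableType d'}.
Context {V : completeNormedModType R}.
Variables (A : V -> set V) (T : R -> V -> V) (A0 : V -> V).
Variables (Theta : Omega -> point_function R Z) (alpha : nat -> Omega -> R).
Variables (x : Omega -> V) (eta : R -> Z -> Omega -> V).

Definition measurable_coefficient :=
  measurable_fun (`]0, +oo[ `*` [set: Z] `*` [set: Omega]
      : set (measurableTypeR R * Z * Omega))
    (fun p : measurableTypeR R * Z * Omega =>
      eta p.1.1 p.1.2 p.2 : borelType V).

Definition strong_solution (Vstar : set {linear V -> R^o})
    (X : R -> Omega -> V) :=
  measurable_fun (`[0, +oo[ `*` [set: Omega] : set (measurableTypeR R * Omega))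
    (fun p : measurableTypeR R * Omega => X p.1 p.2 : borelType V) /\
  {ae P, forall w,
    [/\ X 0 w = x w,
        cadlag (X ^~ w),
        forall t : R, 0 < t -> (forall m, t != alpha m.+1 w) ->
          op_domain A (X t w) &
        forall m a b, alpha m w < a -> a < b -> b < alpha m.+1 w ->
          W11 a b (X ^~ w)] /\
    forall (t : R) (Psi : {linear V -> R^o}), 0 < t -> Vstar Psi ->
      (@lebesgue_measure R).-integrable `]0, t[
        (fun s => (Psi (A0 (X s w)))%:E) /\
      Psi (X t w - x w)
        + \int[@lebesgue_measure R]_(s in `]0, t[) Psi (A0 (X s w))
      = \int[counting_measure (Theta w)]_(p in `]0, t] `*` [set: Z])
          Psi (eta p.1 p.2 w)}.

(* The value 0 off the domain of [Theta w] is only used on a null set. *)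
Definition jump (m : nat) (w : Omega) : V :=
  if Theta w (alpha m w) is Some z then eta (alpha m w) z w else 0.

Fixpoint post_jump (m : nat) (w : Omega) : V :=
  if m is k.+1 then T (alpha m w - alpha k w) (post_jump k w) + jump m w
  else x w.

Definition generated_process (t : R) (w : Omega) : V :=
  limn (series (fun m =>
    \1_(`[alpha m w, alpha m.+1 w[) t *:
      T (Num.max (t - alpha m w) 0) (post_jump m w))).

End ACPRM.

(* Main.v *)
From HB Require Import structures.
Require Import Defs.
From mathcomp Require Import all_boot all_order all_algebra.
From mathcomp Require Import all_classical all_reals all_analysis.
From mathcomp Require Import measurable_realfun ring lra.
Set Implicit Arguments.
Unset Strict Implicit.
Unset Printing Implicit Defensive.
Import Order.TTheory GRing.Theory Num.Theory.
Import numFieldNormedType.Exports.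
Local Open Scope classical_set_scope.
Local Open Scope ring_scope.

(* Kobayashi's estimate compares two Euler schemes and gives, in the limit,
   |u1 (r + t) - u2 s| <= |u1 r - y| + |u2 0 - y| + |z| |t - s| for mild
   solutions u1, u2 and z in A y. As D(A) is dense, it contains the contraction
   and semigroup properties of T and the Lipschitz continuity of T(.)y, y in
   D(A). By domain invariance T(.)v is Lipschitz on [delta, oo[ with right
   derivative - A0 T(.)v everywhere; separability of V and Lebesgue points of
   |A0 T(.)v - q|, q in a countable dense set, turn this into differentiability
   almost everywhere, and the real case gives the integral identity tested
   with Psi, first away from 0 and then on ]0, r[ by integrability.

   For uniqueness, countably many elements of V* separate the points of V, so
   a strong solution Y satisfies Y' = - A0 Y almost everywhere between jumps.
   Since Y(t + h) = T(h)Y(t) + o(h), the absolutely continuous function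
   |Y - T(. - a)Y(a)| has nonpositive right Dini derivative almost everywhere,
   hence vanishes. At a hitting time the values of two solutions that agree
   before it are identified by testing the equation with V*. *)

(** * The Kobayashi estimate *)

(** V is not assumed to have the Radon-Nikodym property, so a Lipschitz curve in V may be nowhere
    differentiable; the right derivative supplied by the generator is what makes differentiability
    almost everywhere provable. The semigroup is given only through Euler schemes, so even its
    semigroup law has to be extracted from a comparison of schemes. Initial and post-jump states
    need not lie in D(A): each orbit is restarted at a later time, after which it is Lipschitz, and
    its behaviour at the starting time is recovered by a limit. Every functional in V* brings its
    own exceptional null set, hence the reduction to countably many. On the probabilistic side the
    sigma-algebra on point functions records only counts, so the mark carried by a hitting time has
    to be recovered from counts before the jumps can be shown measurable; completeness of P enters
    because the structure of the hitting times holds only almost surely. *)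

Section kobayashi.
Context {R : realType} {V : normedModType R}.
Variable A : V -> set V.
Hypothesis accA : accretive A.

(** Convexity of the square: with a and b the two roots, the defect is c (1 - c) (a - b)^2. It
    transfers a convexity bound on [D2] to its root. *)
Lemma convex_sqrt_le (c X Y Z : R) : 0 <= c <= 1 -> 0 <= X -> 0 <= Y ->
  c * X + (1 - c) * Y <= Z ->
  c * Num.sqrt X + (1 - c) * Num.sqrt Y <= Num.sqrt Z.
Proof.
move=> c01 X0 Y0 XYZ.
have sX0 := sqrtr_ge0 X; have sY0 := sqrtr_ge0 Y.
have L0 : 0 <= c * Num.sqrt X + (1 - c) * Num.sqrt Y.
  by rewrite addr_ge0// mulr_ge0//; lra.
rewrite -[leLHS]ger0_norm// -sqrtr_sqr ler_wsqrtr//.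
apply: le_trans XYZ; rewrite -{2}(sqr_sqrtr X0) -{2}(sqr_sqrtr Y0).
set a := Num.sqrt X; set b := Num.sqrt Y.
have : 0 <= c * (1 - c) * (a - b) ^+ 2 by rewrite mulr_ge0 ?sqr_ge0// mulr_ge0; lra.
by rewrite !expr2; nra.
Qed.

(** Accretivity with the step length h as parameter: the difference quotient then cancels p and
    leaves the previous node p'. *)
Lemma accretive_step_point (h : R) p p' f y z : 0 < h ->
  A p (f - h^-1 *: (p - p')) -> A y z ->
  `|p - y| <= `|p' - y| + h * `|f| + h * `|z|.
Proof.
move=> h0 Ap Ay; have h0' := lt0r_neq0 h0.
apply: le_trans (accA h0 Ap Ay) _.
have -> : p - y + h *: (f - h^-1 *: (p - p') - z) = p' - y + h *: f - h *: z.
  rewrite !scalerBr !scalerA divff// !scale1r !opprB !addrA.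
  by rewrite (ACl (4*2*3*6*1*5))%AC/= addrK.
rewrite (le_trans (ler_normB _ _))// !normrZ gtr0_norm// lerD2r.
by rewrite (le_trans (ler_normD _ _))// normrZ gtr0_norm.
Qed.

(** The accretivity parameter is h k / (h + k), which equals both c h and (1 - c) k. It turns p - q
    into c (p' - q) + (1 - c) (p - q'), where each term goes back one step in one of the two
    schemes. *)
Lemma accretive_step (h k c : R) p p' f q q' g : 0 < h -> 0 < k ->
  c = k / (h + k) ->
  A p (f - h^-1 *: (p - p')) -> A q (g - k^-1 *: (q - q')) ->
  `|p - q| <= c * `|p' - q| + (1 - c) * `|p - q'| + c * h * (`|f| + `|g|).
Proof.
move=> h0 k0 cE Ap Aq.
have hk0 : 0 < h + k by rewrite addr_gt0.
have c0 : 0 < c by rewrite cE divr_gt0.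
have h0' := lt0r_neq0 h0; have k0' := lt0r_neq0 k0; have hk0' := lt0r_neq0 hk0.
have c1E : 1 - c = h / (h + k) by rewrite cE; field.
have c1 : 0 <= 1 - c by rewrite c1E divr_ge0// ltW.
have chE : c * h = (1 - c) * k by rewrite c1E cE; field.
have ch0 : 0 < c * h by rewrite mulr_gt0.
apply: le_trans (accA ch0 Ap Aq) _.
have -> : p - q + (c * h) *: (f - h^-1 *: (p - p') - (g - k^-1 *: (q - q'))) =
    c *: (p' - q) + (1 - c) *: (p - q') + (c * h) *: (f - g).
  have chh : c * h * h^-1 = c by rewrite mulfK.
  have chk : c * h * k^-1 = 1 - c by rewrite chE mulfK.
  rewrite !(scalerDr, scalerN, opprD, opprK, scalerA) chh chk.
  rewrite !(scalerDl, scaleNr, scale1r, opprD, opprK) !addrA.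
  by rewrite [LHS](ACl (5*8*1*4*9*10*3*6*7*2))%AC/= addrK.
rewrite (le_trans (ler_normD _ _))// lerD//.
  by rewrite (le_trans (ler_normD _ _))// !normrZ (gtr0_norm c0) (ger0_norm c1).
by rewrite normrZ gtr0_norm// ler_wpM2l ?(ltW ch0)// ler_normB.
Qed.

Section schemes.
Variables (rho : R) (n : nat) (t : nat -> R) (v f : nat -> V).
Hypothesis tP : forall i, (i < n)%N -> 0 < t i.+1 - t i /\ t i.+1 - t i <= rho.
Hypothesis vP : forall i, (i < n)%N ->
  A (v i.+1) (f i.+1 - (t i.+1 - t i)^-1 *: (v i.+1 - v i)).

Let F i := \sum_(k < i) (t k.+1 - t k) * `|f k.+1|.

(** Supplies the boundary values of the double induction in [kobayashi]. *)
Lemma scheme_point i y z : A y z -> (i <= n)%N ->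
  `|v i - y| <= `|v 0 - y| + (t i - t 0) * `|z| + F i.
Proof.
move=> Ayz; elim: i => [|i IH] lein.
  by rewrite /F big_ord0 subrr mul0r !addr0.
have [dt0 _] := tP lein.
apply: le_trans (accretive_step_point dt0 (vP lein) Ayz) _.
have := IH (ltnW lein); rewrite /F big_ord_recr/=; lra.
Qed.

End schemes.

Section schemes.
Variables (rho : R) (n m : nat) (t s : nat -> R) (v w f g : nat -> V).
Hypothesis tP : forall i, (i < n)%N -> 0 < t i.+1 - t i /\ t i.+1 - t i <= rho.
Hypothesis sP : forall j, (j < m)%N -> 0 < s j.+1 - s j /\ s j.+1 - s j <= rho.
Hypothesis vP : forall i, (i < n)%N ->
  A (v i.+1) (f i.+1 - (t i.+1 - t i)^-1 *: (v i.+1 - v i)).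
Hypothesis wP : forall j, (j < m)%N ->
  A (w j.+1) (g j.+1 - (s j.+1 - s j)^-1 *: (w j.+1 - w j)).

Let F i := \sum_(k < i) (t k.+1 - t k) * `|f k.+1|.
Let G j := \sum_(k < j) (s k.+1 - s k) * `|g k.+1|.
(* D2 absorbs the discretization error: the convex combination of its values
   at (x - h, y) and (x, y - k) with weights k / (h + k) and h / (h + k) is at
   most its value at (x, y) as soon as h + k <= 2 rho. *)
Let D2 (x y : R) := (x - y) ^+ 2 + rho * (x + y).
Let D i j := Num.sqrt (D2 (t i - t 0) (s j - s 0)).

Let nodes_ge0 (N : nat) (u : nat -> R) i :
  (forall i, (i < N)%N -> 0 < u i.+1 - u i /\ u i.+1 - u i <= rho) ->
  (i <= N)%N -> 0 <= u i - u 0.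
Proof.
move=> uP; elim: i => [|i IH] iN; first by rewrite subrr.
have [] := uP _ iN; have := IH (ltnW iN); lra.
Qed.

Let rho_ge0 (N : nat) (u : nat -> R) :
  (forall i, (i < N)%N -> 0 < u i.+1 - u i /\ u i.+1 - u i <= rho) ->
  (0 < N)%N -> 0 <= rho.
Proof. by move=> uP /uP[]; lra. Qed.

(** Double induction: when one index is 0, a single scheme is compared with y; the interior case
    goes from the neighbours (i, j.+1) and (i.+1, j) to (i.+1, j.+1). *)
Lemma kobayashi i j y z : A y z -> (i <= n)%N -> (j <= m)%N ->
  `|v i - w j| <= `|v 0 - y| + `|w 0 - y| + `|z| * D i j + F i + G j.
Proof.
move=> Ayz; elim: i j => [|i IHi] j lein lejm.
  have := scheme_point sP wP Ayz lejm.
  have D0 : s j - s 0 <= D 0 j.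
    rewrite -[leLHS]ger0_norm ?(nodes_ge0 sP)// -sqrtr_sqr ler_wsqrtr// /D2.
    rewrite subrr sub0r sqrrN lerDl add0r.
    case: j lejm => [|j] lejm; first by rewrite subrr mulr0.
    by rewrite mulr_ge0 ?(nodes_ge0 sP)// (rho_ge0 sP)// (leq_ltn_trans _ lejm).
  have := ler_wpM2r (normr_ge0 z) D0.
  have := ler_distD y (v 0) (w j); rewrite (distrC y).
  rewrite /F /G big_ord0; lra.
elim: j lejm => [|j IHj] lejm.
  have := scheme_point tP vP Ayz lein.
  have D0 : t i.+1 - t 0 <= D i.+1 0.
    rewrite -[leLHS]ger0_norm ?(nodes_ge0 tP)// -sqrtr_sqr ler_wsqrtr// /D2.
    rewrite subrr subr0 lerDl addr0.
    by rewrite mulr_ge0 ?(nodes_ge0 tP)// (rho_ge0 tP)// (leq_ltn_trans _ lein).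
  have := ler_wpM2r (normr_ge0 z) D0.
  have := ler_distD y (v i.+1) (w 0); rewrite (distrC y).
  rewrite /F /G big_ord0; lra.
have {IHj}Hj := IHj (ltnW lejm); have {IHi}Hi := IHi j.+1 (ltnW lein) lejm.
have [h0 hr] := tP lein; have [k0 kr] := sP lejm.
have rho0 : 0 <= rho by lra.
set h := t i.+1 - t i in h0 hr *; set k := s j.+1 - s j in k0 kr *.
pose c := k / (h + k).
have hk0' : h + k != 0 by rewrite lt0r_neq0// addr_gt0.
have c01 : 0 <= c <= 1.
  have hk0 : 0 < h + k by rewrite addr_gt0.
  rewrite divr_ge0 ?(ltW hk0) ?(ltW k0)//=.
  by rewrite (ler_pdivrMr _ _ hk0) mul1r lerDr ltW.
have chk : c * h = (1 - c) * k by rewrite /c; field.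
apply: le_trans (accretive_step h0 k0 (erefl c) (vP lein) (wP lejm)) _.
have x0 := nodes_ge0 tP (ltnW lein); have y0 := nodes_ge0 sP (ltnW lejm).
have E1 : t i.+1 - t 0 = t i - t 0 + h by rewrite /h; ring.
have E2 : s j.+1 - s 0 = s j - s 0 + k by rewrite /k; ring.
have HD : c * D i j.+1 + (1 - c) * D i.+1 j <= D i.+1 j.+1.
  rewrite /D E1 E2; move: (t i - t 0) (s j - s 0) x0 y0 => x x' x0 x'0.
  apply: convex_sqrt_le => //; rewrite ?/D2.
  - by rewrite addr_ge0 ?sqr_ge0// mulr_ge0//; lra.
  - by rewrite addr_ge0 ?sqr_ge0// mulr_ge0//; lra.
  - rewrite -subr_ge0.
    have -> : (x + h - (x' + k)) ^+ 2 + rho * (x + h + (x' + k)) -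
      (c * ((x - (x' + k)) ^+ 2 + rho * (x + (x' + k))) +
       (1 - c) * ((x + h - x') ^+ 2 + rho * (x + h + x'))) =
       h * k / (h + k) * ((rho - h) + (rho - k)) by rewrite /c; field.
    apply: mulr_ge0; last by lra.
    by apply: divr_ge0; [apply: mulr_ge0|apply: addr_ge0]; exact: ltW.
have HF : F i.+1 = F i + h * `|f i.+1| by rewrite /F big_ord_recr.
have HG : G j.+1 = G j + k * `|g j.+1| by rewrite /G big_ord_recr.
have {}HD := ler_wpM2l (normr_ge0 z) HD.
have := ler_wpM2l (proj1 (andP c01)) Hi.
have c1 : 0 <= 1 - c by lra.
have := ler_wpM2l c1 Hj.
rewrite HF HG.
(* Since c h = (1 - c) k, the step error is exactly what completes the convex combinations of the
   sums F and G to [F i.+1] and [G j.+1]. *)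
have -> : c * h * (`|f i.+1| + `|g j.+1|) =
  h * `|f i.+1| - (1 - c) * (h * `|f i.+1|) + (k * `|g j.+1| - c * (k * `|g j.+1|)).
  by rewrite (_ : k * _ - _ = (1 - c) * k * `|g j.+1|); [rewrite -chk|]; ring.
lra.
Qed.

End schemes.
End kobayashi.

Lemma sum_window_le (R : numDomainType) (a : nat -> R) (i l n : nat) :
  (forall k, (k < n)%N -> 0 <= a k) -> (i + l <= n)%N ->
  \sum_(k < l) a (i + k)%N <= \sum_(k < n) a k.
Proof.
move=> a0 iln.
rewrite -[leRHS](big_mkord xpredT a) (@big_cat_nat _ _ _ i)//=; last first.
  by rewrite (leq_trans _ iln)// leq_addr.
rewrite (@big_cat_nat _ _ _ (i + l)%N i n)//= ?leq_addr//.
have -> : \sum_(i <= k < i + l) a k = \sum_(k < l) a (i + k)%N.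
  rewrite -{1}[i]add0n big_addn addKn big_mkord.
  by apply: eq_bigr => k _; rewrite addnC.
rewrite addrCA lerDl addr_ge0// big_nat_cond sumr_ge0// => k.
- rewrite andbT => /andP[_ kn]; apply: a0.
  by rewrite (leq_trans kn)// (leq_trans _ iln)// leq_addr.
- by rewrite andbT => /andP[_ kn]; exact: a0.
Qed.

Lemma mild_scheme (R : realType) (V : normedModType R) (A : V -> set V) v0 u
    (S e : R) : mild_solution A v0 u -> 0 < S -> 0 < e <= 1 ->
  exists n (t : nat -> R) (v f : nat -> V),
  [/\ forall i, (i < n)%N -> 0 < t i.+1 - t i /\ t i.+1 - t i <= e,
      forall i, (i < n)%N ->
        A (v i.+1) (f i.+1 - (t i.+1 - t i)^-1 *: (v i.+1 - v i)),
      \sum_(i < n) (t i.+1 - t i) * `|f i.+1| <= e,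
      t 0 = 0 /\ `|u 0 - v 0| <= e &
      forall s, 0 <= s <= S -> exists i, [/\ (i <= n)%N,
        s <= t i <= s + e, forall j, (j < i)%N -> t j < s & `|u s - v i| <= e]].
Proof.
move=> [_ u0 uP] S0 /andP[e0 e1].
(* The scheme is run up to S + 1: its last node exceeds S + 1 - e, hence S, so every s in [0, S] has
   a node at or after it. *)
have S10 : 0 < S + 1 by lra.
have [n [t [v [f [[t0 tP [Stn tnS] vP sumf] uv0 uv]]]]] := uP _ _ S10 e0.
exists n, t, v, f; split=> // s /andP[s0 sS].
have ex : exists i, s <= t i by exists n; lra.
(* The first node at or after s: its predecessor lies before s, and the mesh bound gives
   [t i <= s + e]. The index 0 occurs only for s = 0. *)
case: (ex_minnP ex) => i sti imin; exists i.
have lein : (i <= n)%N by apply: imin; lra.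
have ltj j : (j < i)%N -> t j < s.
  by move=> ji; rewrite ltNge; apply/negP => /imin; rewrite leqNgt ji.
split=> //.
- rewrite sti/=; case: i {imin} sti lein ltj => [|i] sti lein ltj; first by lra.
  by have [] := tP _ lein; have := ltj i (ltnSn _); lra.
- case: i {imin} sti lein ltj => [|i] sti lein ltj.
    by rewrite (_ : s = 0)//; lra.
  by apply: uv => //; rewrite in_itv/= sti ltj.
Qed.

Section comparison.
Context {R : realType} {V : normedModType R} (A : V -> set V).
Hypothesis accA : accretive A.

Lemma le_linear_perturbation (X Y C : R) : 0 <= C ->
  (forall h, 0 < h <= 1 -> X <= Y + C * h) -> X <= Y.
Proof.
move=> C0 H; apply/ler_addgt0Pr => e e0.
have C1 : 0 < C + 1 by lra.
have h0 : 0 < Num.min 1 (e / (C + 1)) <= 1.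
  by rewrite lt_min ltr01 divr_gt0//= ge_min lexx.
apply: le_trans (H _ h0) _; rewrite lerD2l.
have : C * Num.min 1 (e / (C + 1)) <= C * (e / (C + 1)).
  by rewrite ler_wpM2l// ge_min lexx orbT.
move/le_trans; apply; rewrite mulrCA ler_piMr ?(ltW e0)// ler_pdivrMr//; lra.
Qed.

Lemma mild_solution_compare v1 u1 v2 u2 y z (r t s : R) :
  mild_solution A v1 u1 -> mild_solution A v2 u2 -> A y z ->
  0 <= r -> 0 <= t -> 0 <= s ->
  `|u1 (r + t) - u2 s| <= `|u1 r - y| + `|v2 - y| + `|z| * `|t - s|.
Proof.
move=> m1 m2 Ayz r0 t0 s0.
(* Six errors of size e enter: the distances of [u1 (r + t)], [u1 r], [v2] and [u2 s] from the
   scheme values, and the two error sums. The rest of the constant comes from the root in [Dle]. *)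
apply: (@le_linear_perturbation _ _ (6 + `|z| * (t + s + 6))).
  by rewrite addr_ge0// mulr_ge0//; lra.
move=> h /andP[h0 h1].
(* Accuracy h^2, because the discretization error enters [kobayashi] under a square root. *)
have e01 : 0 < h ^+ 2 <= 1 by rewrite exprn_gt0//= expr_le1// ltW.
have S0 : 0 < r + t + s + 1 by lra.
have [n [T [v [f [TP vP Fle [T0 u1v] P1]]]]] := mild_scheme m1 S0 e01.
have [m [S [w [g [SP wP Gle [S00 u2w] P2]]]]] := mild_scheme m2 S0 e01.
have eh : h ^+ 2 <= h by rewrite expr2 ler_piMl// ltW.
move: e01 TP SP Fle u1v P1 Gle u2w P2 eh.
move eE : (h ^+ 2) => e /andP[e0 e1] TP SP Fle u1v P1 Gle u2w P2 eh.
have [|i [lein Ti imin ui]] := P1 r; first by lra.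
have [|k [lekn Tk kmin uk]] := P1 (r + t); first by lra.
have [|j [lejm Sj jmin uj]] := P2 s; first by lra.
have leik : (i <= k)%N by rewrite leqNgt; apply/negP => /imin; lra.
have [_ u20 _] := m2.
have ltin l : (l < n - i)%N -> (i + l < n)%N by rewrite ltn_subRL.
(* The first scheme is restarted at i, its first node at or after r, so that y is compared with a
   value close to [u1 r]. *)
have H := @kobayashi R V A accA e (n - i) m (fun l => T (i + l)%N) S
  (fun l => v (i + l)%N) w (fun l => f (i + l)%N) g _ SP _ wP (k - i) j y z Ayz _ lejm.
have {H} : `|v k - w j| <= `|v i - y| + `|w 0 - y| +
    `|z| * Num.sqrt ((T k - T i - S j) ^+ 2 + e * (T k - T i + S j)) + e + e.
  have := H; rewrite !addn0 subnKC// S00 !subr0 => {}H.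
  apply: le_trans (H _ _ _) _.
  - by move=> l ll; rewrite addnS; apply: TP; exact: ltin.
  - by move=> l ll; rewrite addnS; apply: vP; exact: ltin.
  - by rewrite leq_sub2r.
  rewrite lerD//; last first.
    apply: le_trans Gle.
    have := @sum_window_le R (fun l => (S l.+1 - S l) * `|g l.+1|) 0 j m.
    by apply => // l lm; rewrite mulr_ge0//; have [] := SP _ lm; lra.
  rewrite lerD2l; apply: le_trans Fle.
  under eq_bigr do rewrite addnS.
  apply: (@sum_window_le R (fun l => (T l.+1 - T l) * `|f l.+1|)).
    by move=> l lm; rewrite mulr_ge0//; have [] := TP _ lm; lra.
  by rewrite subnKC.
have Dle : Num.sqrt ((T k - T i - S j) ^+ 2 + e * (T k - T i + S j)) <=
    `|t - s| + (t + s + 6) * h.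
  have ts0 := normr_ge0 (t - s).
  have B0 : 0 <= `|t - s| + (t + s + 6) * h.
    by rewrite addr_ge0// mulr_ge0//; lra.
  rewrite -[leRHS]ger0_norm// -sqrtr_sqr ler_wsqrtr//.
  have q1 : `|T k - T i - S j| <= `|t - s| + 2 * h.
    rewrite (_ : T k - T i - S j = t - s + (T k - T i - S j - (t - s))); last by ring.
    apply: le_trans (ler_normD _ _) _; rewrite lerD2l ler_norml; lra.
  have q2 : (T k - T i - S j) ^+ 2 <= (`|t - s| + 2 * h) ^+ 2.
    rewrite -(real_normK (num_real (T k - T i - S j))).
    by rewrite lerXn2r// nnegrE; lra.
  have q3 : e * (T k - T i + S j) <= e * (t + s + 2).
    by rewrite ler_wpM2l ?(ltW e0)//; lra.
  apply: le_trans (lerD q2 q3) _; rewrite -eE -subr_ge0.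
  rewrite (_ : _ - _ = h ^+ 2 * ((t + s) * (t + s + 11) + 30) +
     2 * `|t - s| * h * (t + s + 4)); last by ring.
  apply: addr_ge0; last by rewrite !mulr_ge0//; lra.
  by rewrite mulr_ge0// ?sqr_ge0// addr_ge0// mulr_ge0//; lra.
have {Dle} := ler_wpM2l (normr_ge0 z) Dle.
have a1 := ler_distD (v k) (u1 (r + t)) (u2 s).
have a2 := ler_distD (w j) (v k) (u2 s).
have a3 := ler_distD (u1 r) (v i) y.
have a4 := ler_distD v2 (w 0) y.
rewrite distrC in uj; rewrite (distrC (u1 r)) in ui.
rewrite u20 distrC in u2w.
nra.
Qed.

End comparison.

(** * The semigroup *)

Lemma lipschitz_max0 (R : realDomainType) (t s : R) :
  `|Num.max t 0 - Num.max s 0| <= `|t - s|.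
Proof.
have h1 := ler_norm (t - s); have h2 := ler_norm (s - t).
rewrite distrC in h2; rewrite ler_norml.
by case: (leP t 0) => ?; case: (leP s 0) => ?; apply/andP; split; lra.
Qed.

Section semigroup.
Context {R : realType} {V : normedModType R}.
Variables (A : V -> set V) (T : R -> V -> V).
Hypothesis accA : accretive A.
Hypothesis denseA : densely_defined A.
Hypothesis TP : associated_semigroup A T.

Lemma op_domain_approx v (e : R) : 0 < e -> exists y z, A y z /\ `|v - y| < e.
Proof.
move=> e0; have : closure (op_domain A) v by rewrite denseA.
move=> /(_ (ball v e) (nbhsx_ballx _ _ e0))[y [[z Ayz] vy]].
by exists y, z; split=> //; rewrite -ball_normE in vy.
Qed.

Lemma semigroup0 v : T 0 v = v.
Proof. by case: (TP v). Qed.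

(** At equal times the term in |z| vanishes, so y in D(A) may tend to u without any bound on z. *)
Lemma semigroup_contraction t u v : 0 <= t -> `|T t u - T t v| <= `|u - v|.
Proof.
move=> t0; apply: (@le_linear_perturbation _ _ _ 2) => // e /andP[e0 _].
have [y [z [Ayz uy]]] := op_domain_approx u e0.
have := mild_solution_compare accA (TP u) (TP v) Ayz (lexx 0) t0 t0.
rewrite add0r subrr normr0 mulr0 semigroup0.
have := ler_distD u v y; rewrite (distrC v u); lra.
Qed.

Lemma semigroup_lipschitz t s y z : A y z -> 0 <= t -> 0 <= s ->
  `|T t y - T s y| <= `|z| * `|t - s|.
Proof.
move=> Ayz t0 s0.
have := mild_solution_compare accA (TP y) (TP y) Ayz (lexx 0) t0 s0.
by rewrite add0r semigroup0 subrr normr0 !add0r.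
Qed.

(** The orbit of v from time r on is compared, at equal times, with the orbit issued from [T r v],
    and y tends to [T r v]. *)
Lemma semigroupD r t v : 0 <= r -> 0 <= t -> T (r + t) v = T t (T r v).
Proof.
move=> r0 t0; apply/eqP; rewrite -subr_eq0 -normr_le0.
apply: (@le_linear_perturbation _ _ _ 2) => // e /andP[e0 _].
have [y [z [Ayz uy]]] := op_domain_approx (T r v) e0.
have := mild_solution_compare accA (TP v) (TP (T r v)) Ayz r0 t0 t0.
by rewrite subrr normr0 mulr0; lra.
Qed.

(** The truncation makes this a statement on the whole line, [T] being arbitrary at negative times.
    An orbit issued from a point of D(A) close to v is Lipschitz and, by contraction, uniformly
    close. *)
Lemma semigroup_continuous v : continuous (fun t : R => T (Num.max t 0) v : V).
Proof.
move=> t; apply/cvgrPdist_le => e e0.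
have e3 : 0 < e / 3 by rewrite divr_gt0.
have [y [z [Ayz uy]]] := op_domain_approx v e3.
have z1 : 0 < `|z| + 1 by rewrite ltr_wpDl.
near=> s.
have ts : `|t - s| < e / 3 / (`|z| + 1).
  by near: s; apply: cvgr_dist_lt; [exact: cvg_id|rewrite divr_gt0].
have mt : 0 <= Num.max t 0 by rewrite le_max lexx orbT.
have ms : 0 <= Num.max s 0 by rewrite le_max lexx orbT.
have l1 := semigroup_contraction v y mt.
have l2 := semigroup_contraction y v ms.
have l3 := semigroup_lipschitz Ayz mt ms.
have := ler_wpM2l (normr_ge0 z) (lipschitz_max0 t s).
have : `|z| * `|t - s| <= e / 3.
  apply: le_trans (_ : (`|z| + 1) * `|t - s| <= _).
    by rewrite ler_wpM2r// lerDl.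
  by rewrite mulrC -ler_pdivlMr// ltW.
have := ler_distD (T (Num.max t 0) y) (T (Num.max t 0) v) (T (Num.max s 0) v).
have := ler_distD (T (Num.max s 0) y) (T (Num.max t 0) y) (T (Num.max s 0) v).
rewrite (distrC y v) in l2; lra.
Unshelve. all: by end_near. Qed.

Variable A0 : V -> V.
Hypothesis A0P : infinitesimal_generator A T A0.

Lemma semigroup_right_derivative t v : 0 <= t -> op_domain A (T t v) ->
  h^-1 *: (T (t + h) v - T t v) @[h --> 0^'+] --> - A0 (T t v).
Proof.
move=> t0 Dv; have [/(_ _ Dv)[+ _] _] := A0P.
move=> /cvgN; apply: cvg_trans; apply: near_eq_cvg.
near=> h => /=; rewrite opprK semigroupD//.
Unshelve. all: by end_near. Qed.

End semigroup.

(** * Absolutely continuous functions and Dini derivatives *)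

Section absolutely_continuous_monotone.
Context {R : realType}.
Notation mu := (@lebesgue_measure R).

Lemma negligible_open_cover (E : set R) (d : R) : mu.-negligible E -> 0 < d ->
  exists W : set R, [/\ open W, E `<=` W & (mu W < d%:E)%E].
Proof.
move=> [B [mB B0 EB]] d0.
have Boo : (mu B < +oo)%E by rewrite B0 ltry.
have [W [oW BW Od]] := lebesgue_regularity_outer mB Boo d0.
exists W; split=> //; first exact: subset_trans EB BW.
have mW := open_measurable oW.
have -> : W = B `|` (W `\` B) by rewrite setDUK.
have : (mu (B `|` (W `\` B)) <= mu B + mu (W `\` B))%E.
  by apply: measureU2 => //; exact: measurableD.
by rewrite B0 add0e => /le_lt_trans; exact.
Qed.

Lemma absolutely_continuous_right_dini_le0 (phi : R -> R^o) (a b : R)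
    (E : set R) : a <= b -> absolutely_continuous_on a b phi ->
  mu.-negligible E ->
  (forall t, a <= t < b -> ~ E t -> forall e : R, 0 < e ->
    \forall h \near 0^'+, phi (t + h) <= phi t + e * h) ->
  phi b <= phi a.
Proof.
move=> ab ac nE dini.
(* The final cost is e (b - a) for the slope, e for the intervals inside the cover and e for the
   slack. *)
apply: (@le_linear_perturbation _ _ _ (b - a + 2)); first lra.
move=> e /andP[e0 _].
have [d d0 dP] := ac e e0.
have [W [oW EW mOd]] := negligible_open_cover nE d0.
have mW := open_measurable oW.
(* Inside the open cover W of E the growth of phi is charged to disjoint
   intervals of total length at most mu W, elsewhere to the slope e. The slack
   x in Q makes Q closed under increasing limits. *)
pose fam t n (l r : nat -> R) := [/\
  forall i, (i < n)%N -> [/\ a <= l i, l i <= r i & r i <= t],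
  forall i j, (i < n)%N -> (j < n)%N -> i != j -> r i <= l j \/ r j <= l i &
  ((\sum_(i < n) (r i - l i))%:E <= mu (W `&` `]a, t]))%E].
pose Q t := forall x : R, 0 < x -> exists n l r, fam t n l r /\
  phi t - phi a <= e * (t - a) + \sum_(i < n) `|phi (r i) - phi (l i)| + x.
have Qa : Q a.
  move=> x x0; exists 0, (fun=> a), (fun=> a); split; first split => //.
    by rewrite big_ord0 measure_ge0.
  by rewrite big_ord0; lra.
(* Continuity induction: the supremum c of S satisfies Q, and if c < b then so does some c + h with
   h > 0. *)
pose S := [set t | a <= t <= b /\ Q t].
have Sa : S a by rewrite /S/= lexx ab.
have hS : has_sup S by split; [exists a|exists b => t [/andP[]]].
pose c := sup S.
have ac' : a <= c by apply: ub_le_sup => //; case: hS.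
have cb : c <= b by apply: ge_sup; [exists a|move=> t [/andP[]]].
have Qc : Q c.
  (* Half of the slack is spent at a point t of S close to c, the other half on the increment of phi
     from t to c. *)
  move=> x x0; have x20 : 0 < x / 2 by rewrite divr_gt0.
  have [d' d'0 d'P] := ac _ x20.
  have [t [tab Qt] ct] := sup_adherent d'0 hS; rewrite -/c in ct.
  have tc : t <= c by apply: ub_le_sup => //; case: hS.
  have [n [l [r [[lr dis slr] tl]]]] := Qt _ x20.
  exists n, l, r; split.
    split => //; first by move=> i /lr[? ? ?]; split => //; exact: le_trans tc.
    apply: (le_trans slr); rewrite le_measure ?inE//; do 1?[by apply: measurableI].
    by move=> u [Ou]; rewrite /= !in_itv/= => /andP[au ut]; split=> //; rewrite au (le_trans ut).
  have := d'P 1 (fun=> t) (fun=> c); rewrite !big_ord_recr !big_ord0/= !add0r.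
  have -> : `|phi c - phi t| = `|(phi c : R) - phi t| by [].
  move=> /(_ _ _ _) H.
  have {}H : `|(phi c : R) - phi t| < x / 2.
    apply: H; last lra.
      by move=> _; move/andP : tab => [? ?]; split => //; split.
    by move=> i j; rewrite !ord1.
  have := ler_norm ((phi c : R) - phi t).
  have : e * (t - a) <= e * (c - a) by rewrite ler_wpM2l ?(ltW e0)//; lra.
  lra.
have : c = b.
  apply/eqP; rewrite eq_le cb/= leNgt; apply/negP => cltb.
  suff [h h0 [hb Qh]] : exists2 h, 0 < h & c + h <= b /\ Q (c + h).
    have : c + h <= c by apply: ub_le_sup; [case: hS|split=> //; apply/andP; split; lra].
    lra.
  have [Oc|nOc] := pselect (W c).
    (* Inside W the interval from c to c + h joins the family as its member of index n, and W
       absorbs its length. *)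
    have /nbhs_ballP[del del0 delO] : nbhs c W by exact: open_nbhs_nbhs.
    rewrite /= in del0.
    pose h := Num.min (del / 2) (b - c).
    have h0 : 0 < h by rewrite lt_min divr_gt0//= subr_gt0.
    have hdel : h <= del / 2 by rewrite ge_min lexx.
    have hbc : h <= b - c by rewrite ge_min lexx orbT.
    exists h => //; split; first lra.
    move=> x x0; have [n [l [r [[lr dis slr] tl]]]] := Qc _ x0.
    pose l' i := if (i < n)%N then l i else c.
    pose r' i := if (i < n)%N then r i else c + h.
    have Er : \sum_(i < n) (r' i - l' i) = \sum_(i < n) (r i - l i).
      by apply: eq_bigr => i _; rewrite /r' /l' ltn_ord.
    have Ep : \sum_(i < n) `|phi (r' i) - phi (l' i)| = \sum_(i < n) `|phi (r i) - phi (l i)|.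
      by apply: eq_bigr => i _; rewrite /r' /l' ltn_ord.
    exists n.+1, l', r'; split.
      split.
      - move=> i _; rewrite /l' /r'; case: ifPn => [/lr[? ? ?]|_]; last by split=> //; lra.
        by split => //; lra.
      - move=> i j; rewrite !ltnS => lei lej ij; rewrite /l' /r'.
        case: ifPn => ni; case: ifPn => nj.
        + exact: dis.
        + by left; have [] := lr _ ni.
        + by right; have [] := lr _ nj.
        + have ei : i = n by apply/eqP; rewrite eqn_leq lei leqNgt ni.
          have ej : j = n by apply/eqP; rewrite eqn_leq lej leqNgt nj.
          by rewrite ei ej eqxx in ij.
      - rewrite big_ord_recr/= Er /r' /l' ltnn.
        have -> : W `&` `]a, c + h] = (W `&` `]a, c]) `|` `]c, c + h].
          apply/seteqP; split => u /=; rewrite !in_itv/=.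
            move=> [Ou /andP[au uch]]; have [uc|uc] := leP u c.
              by left; rewrite au.
            by right.
          move=> [[Ou /andP[au uc]]|/andP[cu uch]].
            by split=> //; rewrite au/=; lra.
          split; last by apply/andP; split; lra.
          by apply: delO; rewrite /ball/= ltr_norml; apply/andP; split; lra.
        rewrite measureU//=; last 2 first.
          by apply: measurableI => //.
          by apply/seteqP; split => u //=; rewrite !in_itv/= => -[[_ /andP[? ?]]/andP[? ?]]; lra.
        rewrite EFinD leeD// lebesgue_measure_itv/= lte_fin ifT; last lra.
        by rewrite -EFinB lee_fin; lra.
    rewrite big_ord_recr/= Ep /r' /l' ltnn.
    have := ler_norm ((phi (c + h) : R) - phi c).
    have -> : `|phi (c + h) - phi c| = `|(phi (c + h) : R) - phi c| by [].
    have : 0 <= e * h by rewrite mulr_ge0// ltW.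
    rewrite (_ : c + h - a = (c - a) + h); last by ring.
    rewrite mulrDr; lra.
  (* Off W the Dini condition pays for a step to the right with slope e, and the family stays as it
     is. *)
  have /(_ _ e0) dc : forall e : R, 0 < e -> \forall h \near 0^'+, phi (c + h) <= phi c + e * h.
    by apply: dini; [rewrite ac'|move=> /EW].
  have bc0 : 0 < b - c by lra.
  near (0 : R)^'+ => h.
  have h0 : 0 < h by near: h; exact: nbhs_right_gt.
  have hbc : h <= b - c by near: h; exact: nbhs_right_le.
  exists h => //; split; first lra.
  have ph : phi (c + h) <= phi c + e * h by near: h.
  move=> x x0; have [n [l [r [[lr dis slr] tl]]]] := Qc _ x0.
  exists n, l, r; split.
    split=> //; first by move=> i /lr[? ? ?]; split => //; lra.
    apply: (le_trans slr); rewrite le_measure ?inE//; do 1?[by apply: measurableI].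
    by move=> u [Ou]; rewrite /= !in_itv/= => /andP[au ut]; split=> //; rewrite au/=; lra.
  rewrite (_ : c + h - a = (c - a) + h); last by ring.
  rewrite mulrDr; lra.
move=> cE; rewrite cE in Qc.
have [n [l [r [[lr dis slr] tl]]]] := Qc _ e0.
have : \sum_(i < n) `|phi (r i) - phi (l i)| < e.
  apply: (dP n (fun i => l i) (fun i => r i)).
  - by move=> i; have [] := lr i (ltn_ord i).
  - by move=> i j ij; exact: dis.
  - rewrite -lte_fin; apply: le_lt_trans mOd; apply: le_trans slr _.
    by rewrite le_measure ?inE//; apply: measurableI.
lra.
Unshelve. all: by end_near. Qed.

End absolutely_continuous_monotone.

Section difference_quotient.
Context {R : realType} {V : normedModType R}.

Lemma derivable_difference_quotient (f : R -> V) (x : R) :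
  derivable (f : R^o -> V) x 1 ->
  h^-1 *: (f (x + h) - f x) @[h --> 0^'] --> 'D_1 (f : R^o -> V) x.
Proof.
move=> df.
have : h^-1 *: ((f \o shift x) (h *: (1 : R^o)) - f x) @[h --> 0^'] -->
    'D_1 (f : R^o -> V) x by exact: df.
apply: cvg_trans; apply: near_eq_cvg; near=> h.
have e1 : h *: (1 : R^o) = h by rewrite /GRing.scale/= mulr1.
by rewrite /= e1 (addrC h).
Unshelve. all: by end_near. Qed.

Lemma difference_quotient_derivable (f : R -> V) (x : R) (l : V) :
  h^-1 *: (f (x + h) - f x) @[h --> 0^'] --> l -> derivable (f : R^o -> V) x 1.
Proof.
move=> fl; apply/cvg_ex; exists l; apply: cvg_trans fl; apply: near_eq_cvg.
near=> h; have e1 : h *: (1 : R^o) = h by rewrite /GRing.scale/= mulr1.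
by rewrite /= e1 (addrC h).
Unshelve. all: by end_near. Qed.

Lemma lipschitz_absolutely_continuous (f : R -> V) (L a b : R) : 0 <= L ->
  (forall s t, a <= s -> s <= t -> t <= b -> `|f t - f s| <= L * (t - s)) ->
  absolutely_continuous_on a b f.
Proof.
move=> L0 fL e e0; exists (e / (L + 1)); first by rewrite divr_gt0// ltr_wpDl.
move=> n l r lr _; rewrite ltr_pdivlMr ?ltr_wpDl// => sd.
apply: le_lt_trans sd; rewrite mulr_suml; apply: ler_sum => i _.
have [al [lri rb]] := lr i.
apply: (le_trans (fL _ _ al lri rb)).
by rewrite mulrC ler_wpM2l ?subr_ge0// lerDl.
Qed.

Lemma right_derivative_near (f : R -> V) (x : R) (l : V) (e : R) : 0 < e ->
  h^-1 *: (f (x + h) - f x) @[h --> 0^'+] --> l ->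
  \forall h \near 0^'+, `|f (x + h) - f x - h *: l| <= e * h.
Proof.
move=> e0 /cvgrPdist_le/(_ _ e0); apply: filterS2 (nbhs_right_gt (0 : R)).
move=> h h0 H.
have -> : f (x + h) - f x - h *: l = h *: (h^-1 *: (f (x + h) - f x) - l).
  by rewrite scalerBr scalerA divff ?gt_eqF// scale1r.
by rewrite normrZ gtr0_norm// mulrC ler_pM2r// distrC.
Qed.

End difference_quotient.

(** * Primitives of bounded measurable functions *)

Section bounded_primitive.
Context {R : realType}.
Notation mu := (@lebesgue_measure R).
Variables (g : R -> R) (M : R) (a : R).
Hypothesis mg : measurable_fun [set: measurableTypeR R] g.
Hypothesis gM : forall t, `|g t| <= M.

Lemma bounded_integrable (D : set (measurableTypeR R)) :
  measurable D -> (mu D < +oo)%E -> mu.-integrable D (EFin \o g).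
Proof.
move=> mD Doo; apply: measurable_bounded_integrable => //.
  exact: measurable_funS mg.
exists M; split; first by rewrite num_real.
by move=> x Mx t _; apply: le_trans (ltW Mx); exact: gM.
Qed.

Let G x := \int[mu]_(t in `[a, x]) g t.

Let itv_oo (b c : bool) (x y : R) : (mu [set` Interval (BSide b x) (BSide c y)] < +oo)%E.
Proof. by rewrite lebesgue_measure_itv/=; case: ifP => // _; rewrite -EFinB ltry. Qed.

Lemma bounded_primitive_lipschitz x y : a <= x -> x <= y ->
  `|G y - G x| <= M * (y - x).
Proof.
move=> ax xy; rewrite /G Rintegral_itvB ?bnd_simp//; last first.
  by apply: bounded_integrable => //; exact: itv_oo.
apply: (le_trans (le_normr_Rintegral _ _)) => //.
  by apply: bounded_integrable => //; exact: itv_oo.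
have <- : \int[mu]_(t in `]x, y]) M = M * (y - x).
  rewrite Rintegral_cst//; congr (M * _).
  have := @lebesgue_measure_itv R `]x, y]; rewrite /= lte_fin => mE.
  rewrite [X in fine X]mE; case: ltgtP xy => // -> _.
  by rewrite subrr.
apply: le_Rintegral => //.
- apply: measurable_bounded_integrable => //; first exact: itv_oo.
    by apply: measurableT_comp => //; exact: measurable_funS mg.
  exists M; split; first by rewrite num_real.
  by move=> z Mz t _; rewrite /= normr_id; apply: le_trans (ltW Mz); exact: gM.
- apply: measurable_bounded_integrable => //; first exact: itv_oo.
  exists `|M|; split; first by rewrite num_real.
  by move=> z Mz t _ /=; exact: ltW.
Qed.

Lemma bounded_primitive_derivative : exists2 E : set R, mu.-negligible E &
  forall x, a < x -> ~ E x -> h^-1 *: (G (x + h) - G x : R^o) @[h --> 0^'] --> (g x : R^o).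
Proof.
have loc : locally_integrable [set: R] g.
  split => //; first exact: openT.
  move=> K _ cK; have mK := compact_measurable cK.
  have : mu.-integrable K (EFin \o g).
    by apply: bounded_integrable => //; exact: compact_finite_measure.
  by case/integrableP.
have int y : mu.-integrable [set` Interval (BLeft a) (BRight y)] (EFin \o g).
  exact: bounded_integrable.
have [B [mB B0 HB]] := FTC1 int loc.
exists B; first by exists B; split.
move=> x ax nB.
have [|dG <-] := contrapT (contra_not (@HB x) nB); first by rewrite lte_fin.
by rewrite derive1E; exact: derivable_difference_quotient.
Qed.

End bounded_primitive.

(** * Lipschitz functions with a right derivative *)

Lemma separable_sequence (R : realType) (V : normedModType R) : separable V ->
  exists q : nat -> V, forall v (e : R), 0 < e -> exists n, `|v - q n| < e.
Proof.
move=> [D /countable_injP[f finj] denseD].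
(* Point n is the element of D whose code is n; numbers that code nothing give 0. *)
exists (fun n => xget 0 [set d | D d /\ f d = n]) => v e e0.
have [|w [vw Dw]] := denseD (ball v e) _ (ball_open v e).
  by exists v; exact: ballxx.
exists (f w); have [Dg fg] : (D `&` [set d | f d = f w]) (xget 0 [set d | D d /\ f d = f w]).
  by apply: (@xgetPex _ 0 [set d | D d /\ f d = f w]); exists w.
have -> : xget 0 [set d | D d /\ f d = f w] = w by apply: finj; rewrite ?inE.
by rewrite -ball_normE in vw.
Qed.

Lemma harmonic_at_right (R : realType) :
  (n.+1%:R^-1 : R) @[n --> \oo] --> 0^'+.
Proof.
move=> P [d/= d0 HP].
have : \forall n \near \oo, `|0 - n.+1%:R^-1 : R| < d.
  by apply: cvgr_dist_lt => //; exact: cvg_harmonic.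
by apply: filterS => n /= nd; apply: HP => //=; rewrite invr_gt0.
Qed.

Section lipschitz_right_differentiable.
Context {R : realType} {V : normedModType R}.
Notation mu := (@lebesgue_measure R).
Variables (f g : R -> V) (L : R).
Hypothesis L0 : 0 <= L.
Hypothesis fL : forall s t, `|f t - f s| <= L * `|t - s|.
Hypothesis fg : forall t, h^-1 *: (f (t + h) - f t) @[h --> 0^'+] --> g t.

Lemma lipschitz_right_derivative_le t : `|g t| <= L.
Proof.
apply: (@le_linear_perturbation _ _ _ 1) => // e /andP[e0 _]; rewrite mul1r.
near (0 : R)^'+ => h.
have h0 : 0 < h by near: h; exact: nbhs_right_gt.
have H : `|f (t + h) - f t - h *: g t| <= e * h.
  by near: h; exact: right_derivative_near.
have := fL t (t + h); rewrite (addrC t) addrK (gtr0_norm h0) (addrC h).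
have hg : `|h *: g t| = h * `|g t| by rewrite normrZ gtr0_norm.
move=> fLh; rewrite -(ler_pM2r h0) mulrDl.
have := ler_distD (f (t + h) - f t) (h *: g t) 0; rewrite !subr0 (distrC (h *: _)).
lra.
Unshelve. all: by end_near. Qed.

Let cf : continuous f.
Proof.
move=> t; apply/cvgrPdist_le => e e0; near=> s.
apply: le_trans (fL _ _) _; apply: le_trans (_ : (L + 1) * `|t - s| <= _).
  by rewrite ler_wpM2r// lerDl.
rewrite mulrC -ler_pdivlMr ?ltr_wpDl//.
by near: s; apply: cvgr_dist_le; [exact: cvg_id|rewrite divr_gt0// ltr_wpDl].
Unshelve. all: by end_near. Qed.

(** A pointwise limit of continuous functions, by difference quotients along the steps 1 / (n + 1).
    Only scalar distances are handled, so no sigma-algebra on V enters. *)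
Lemma measurable_dist_right_derivative q :
  measurable_fun [set: measurableTypeR R] (fun t => `|g t - q|).
Proof.
pose k (n : nat) (t : measurableTypeR R) : R :=
  `|((n.+1%:R : R)^-1)^-1 *: (f (t + n.+1%:R^-1) - f t) - q|.
have mk n : measurable_fun [set: measurableTypeR R] (k n).
  rewrite /k; apply: continuous_measurable_fun => t.
  apply: cvg_norm; apply: cvgB; last exact: cvg_cst.
  apply: cvgZr; apply: cvgB; last exact: cf.
  apply: (@continuous_comp _ _ _ (fun u : R => u + n.+1%:R^-1) f); last exact: cf.
  by apply: cvgD; [exact: cvg_id|exact: cvg_cst].
have kg t : setT t -> k n t @[n --> \oo] --> `|g t - q|.
  move=> _; apply: cvg_norm; apply: cvgB; last exact: cvg_cst.
  exact: (@cvg_comp _ _ _ (fun n : nat => (n.+1%:R : R)^-1)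
    (fun h : R => h^-1 *: (f (t + h) - f t)) _ _ _ (@harmonic_at_right R) (@fg t)).
exact: (measurable_fun_cvg mk kg).
Qed.

(** Monotonicity of N - F, where N s is the norm of f s - f x - (s - x) q: the right Dini derivative
    of N at s is at most |g s - q|, which is the derivative of F almost everywhere. *)
Lemma lipschitz_mean_value q a x y (F := fun x => \int[mu]_(t in `[a, x]) `|g t - q|) :
  a < x -> x <= y -> `|f y - f x - (y - x) *: q| <= F y - F x.
Proof.
move=> ax xy; pose k t := `|g t - q|.
have mk : measurable_fun [set: measurableTypeR R] k.
  exact: measurable_dist_right_derivative.
have kM t : `|k t| <= L + `|q|.
  rewrite normr_id; apply: le_trans (ler_normB _ _) _.
  by rewrite lerD2r lipschitz_right_derivative_le.
have [E nE FE] := @bounded_primitive_derivative _ _ _ a mk kM.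
pose N s := `|f s - f x - (s - x) *: q|.
have NB s t : N t - N s <= `|f t - f s - (t - s) *: q|.
  have <- : f t - f x - (t - x) *: q - (f s - f x - (s - x) *: q) =
            f t - f s - (t - s) *: q.
    rewrite !(scalerBl, opprD, opprK) !addrA.
    by rewrite [LHS](ACl (1*5*3*7*2*6*4*8))%AC/= addrK subrK.
  exact: lerB_dist.
have NL s t : `|N t - N s| <= (L + `|q|) * `|t - s|.
  have B u v : `|f u - f v - (u - v) *: q| <= (L + `|q|) * `|u - v|.
    apply: le_trans (ler_normB _ _) _; rewrite mulrDl normrZ (mulrC _ `|q|).
    by rewrite lerD2r.
  rewrite ler_norml lerNl opprB; apply/andP; split.
    by rewrite distrC; exact: le_trans (NB _ _) (B _ _).
  exact: le_trans (NB _ _) (B _ _).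
have : N y - F y <= N x - F x.
  apply: (@absolutely_continuous_right_dini_le0 _ (fun s => N s - F s) x y E) => //.
  - apply: (@lipschitz_absolutely_continuous _ _ _ ((L + `|q|) + (L + `|q|))).
      by rewrite !addr_ge0.
    move=> s t xs st ty.
    rewrite (_ : _ - _ = (N t - N s : R^o) - (F t - F s)); last first.
      by rewrite opprB opprD opprK addrACA [F s - _]addrC.
    apply: le_trans (ler_normB _ _) _; rewrite mulrDl lerD//.
      by apply: le_trans (NL _ _) _; rewrite ger0_norm ?subr_ge0.
    by apply: bounded_primitive_lipschitz => //; lra.
  - move=> t /andP[xt ty] Et e e0.
    have e20 : 0 < e / 2 by rewrite divr_gt0.
    have H1 := right_derivative_near e20 (@fg t).
        have H2 : \forall h \near 0^'+, `|F (t + h) - F t - h *: (k t : R^o)| <= e / 2 * h.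
      apply: (@right_derivative_near _ R^o) => //.
      by apply: cvg_dnbhs_at_right; apply: FE => //; lra.
    near=> h.
    have h0 : 0 < h by near: h; exact: nbhs_right_gt.
    have A1 : `|f (t + h) - f t - h *: g t| <= e / 2 * h by near: h.
    have : `|F (t + h) - F t - h *: (k t : R^o)| <= e / 2 * h by near: h.
    rewrite ler_norml => /andP[A2 _].
    have := NB t (t + h); rewrite (addrC t) addrK (addrC h).
    have : `|f (t + h) - f t - h *: q| <= e / 2 * h + h * k t.
      have := ler_distD (h *: g t) (f (t + h) - f t) (h *: q).
      by rewrite -scalerBr normrZ gtr0_norm// -/(k t); lra.
    move: A2; rewrite /GRing.scale/=; lra.
have -> : N x = 0 by rewrite /N !subrr scale0r subrr normr0.
rewrite /N; lra.
Unshelve. all: by end_near. Qed.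

(** The mean value inequality is available on either side of t, which is how a right derivative
    becomes two-sided. The difference quotient differs from q n by at most a mean of |g - q n|, and
    this mean tends to |g t - q n| < e / 4. *)
Lemma lipschitz_ae_derivative (a : R) : separable V -> exists2 E : set R,
  mu.-negligible E & forall t, a < t -> ~ E t ->
    h^-1 *: (f (t + h) - f t) @[h --> 0^'] --> g t.
Proof.
move=> /separable_sequence[q qP].
have mk n := measurable_dist_right_derivative (q n).
have kM n t : `| `|g t - q n| | <= L + `|q n|.
  rewrite normr_id; apply: le_trans (ler_normB _ _) _.
  by rewrite lerD2r lipschitz_right_derivative_le.
have EP n := @bounded_primitive_derivative _ _ _ a (mk n) (kM n).
pose E n := projT1 (cid2 (EP n)).
exists (\bigcup_n E n).
  by apply: negligible_bigcup => n; rewrite /E; case: cid2.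
move=> t at_ nE; apply/cvgrPdist_le => e e0.
have e40 : 0 < e / 4 by rewrite divr_gt0.
have [n qn] := qP (g t) _ e40.
have {}nE : ~ E n t by move=> Et; apply: nE; exists n.
move: nE; rewrite /E; case: cid2 => B /= _ /(_ t at_) + nB => /(_ nB).
set F := (fun x => \int[mu]_(t in `[a, x]) `|g t - q n|).
move=> /cvgrPdist_le /(_ _ e40) Fd.
near=> h.
have h0 : h != 0 by near: h; exact: nbhs_dnbhs_neq.
have ath : a < t + h.
  have : `|h| < t - a.
    by near: h; apply: dnbhs0_lt; rewrite subr_gt0.
  by rewrite ltr_norml => /andP[]; lra.
have H : `| `|g t - q n| - h^-1 * (F (t + h) - F t)| <= e / 4 by near: h; exact: Fd.
have ah0 : 0 < `|h| by rewrite normr_gt0.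
have K : `|f (t + h) - f t - h *: q n| <= `|F (t + h) - F t|.
  have [hp|hn] := leP 0 h.
    apply: le_trans (ler_norm _).
    have := @lipschitz_mean_value (q n) a t (t + h) at_.
    by rewrite lerDl => /(_ hp); rewrite (addrC t) addrK (addrC h).
  rewrite [leRHS]distrC; apply: le_trans (ler_norm _).
  have := @lipschitz_mean_value (q n) a (t + h) t ath.
  rewrite gerDl => /(_ (ltW hn)); apply: le_trans.
  rewrite opprD addrA subrr sub0r scaleNr opprK -normrN !opprD !opprK.
  by rewrite [- _ + _]addrC.
have {}K : `|h^-1 *: (f (t + h) - f t) - q n| <= `|h^-1 * (F (t + h) - F t)|.
  have -> : h^-1 *: (f (t + h) - f t) - q n = h^-1 *: (f (t + h) - f t - h *: q n).
    by rewrite [RHS]scalerBr scalerA mulVf// scale1r.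
  by rewrite normrZ normrM ler_wpM2l.
have := ler_distD (q n) (g t) (h^-1 *: (f (t + h) - f t)).
rewrite (distrC (q n)).
have := ler_norm (h^-1 * (F (t + h) - F t) - `|g t - q n|).
have := ler_distD (`|g t - q n|) (h^-1 * (F (t + h) - F t)) 0.
rewrite !subr0 normr_id; rewrite distrC in H.
lra.
Unshelve. all: by end_near. Qed.

End lipschitz_right_differentiable.

Section lipschitz_ftc.
Context {R : realType}.
Notation mu := (@lebesgue_measure R).
Variables (f g : R -> R) (L : R).
Hypothesis L0 : 0 <= L.
Hypothesis fL : forall s t, `|f t - f s| <= L * `|t - s|.
Hypothesis fg : forall t, h^-1 *: (f (t + h) - f t : R^o) @[h --> 0^'+] --> (g t : R^o).

Lemma lipschitz_ftc x y : x <= y -> f y - f x = \int[mu]_(t in `]x, y]) g t.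
Proof.
move=> xy.
have gM t : `|g t| <= L by exact: (@lipschitz_right_derivative_le _ R^o f g).
have mg : measurable_fun [set: measurableTypeR R] g.
  (* Since |g| <= L, g is recovered from its distance to -L, and such distances are known to be
     measurable. *)
  rewrite (_ : g = fun t => `|g t - (- L)| - L).
    apply: measurable_funB => //.
    exact: (@measurable_dist_right_derivative _ R^o f g L).
  apply/funext => t; rewrite opprK ger0_norm ?addrK//.
  by have := gM t; rewrite ler_norml => /andP[]; lra.
(* Based at x - 1, so that every point of [x, y] lies strictly to the right of the base point. *)
pose G x' := \int[mu]_(t in `[x - 1, x']) g t.
have [E nE GE] := @bounded_primitive_derivative _ _ _ (x - 1) mg gM.
have GL := @bounded_primitive_lipschitz _ _ _ (x - 1) mg gM.
(* The cases c = 1 and c = -1 together show that f - G takes the same value at x and y. *)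
have key (c : R) : `|c| = 1 -> c * (f y - G y) <= c * (f x - G x).
  move=> c1.
  apply: (@absolutely_continuous_right_dini_le0 _ (fun s => c * (f s - G s)) x y E) => //.
  - apply: (@lipschitz_absolutely_continuous _ _ _ (L + L)); first by rewrite addr_ge0.
    move=> s t xs st ty.
    rewrite (_ : _ - _ = c * ((f t - f s) - (G t - G s))); last by ring.
    rewrite normrM c1 mul1r; apply: le_trans (ler_normB _ _) _; rewrite mulrDl lerD//.
      by apply: le_trans (fL _ _) _; rewrite ger0_norm ?subr_ge0.
    by apply: GL => //; lra.
  - move=> t /andP[xt ty] Et e e0.
    have e20 : 0 < e / 2 by rewrite divr_gt0.
    have H1 := @right_derivative_near _ R^o _ _ _ _ e20 (@fg t).
    have H2 : \forall h \near 0^'+, `|(G (t + h) : R^o) - G t - h *: (g t : R^o)| <= e / 2 * h.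
      apply: (@right_derivative_near _ R^o) => //.
      by apply: cvg_dnbhs_at_right; apply: GE => //; lra.
    near=> h.
    have A1 : `|(f (t + h) : R) - f t - h * g t| <= e / 2 * h by near: h.
    have A2 : `|(G (t + h) : R) - G t - h * g t| <= e / 2 * h by near: h.
    rewrite -lerBlDl (_ : _ - _ = c * ((f (t + h) - f t - h * g t) -
      (G (t + h) - G t - h * g t))); last by ring.
    apply: le_trans (ler_norm _) _; rewrite normrM c1 mul1r.
    by apply: le_trans (ler_normB _ _) _; lra.
have e1 := key 1 (normr1 _).
have e2 := key (-1) (normrN1 _).
have -> : f y - f x = G y - G x by lra.
rewrite /G Rintegral_itvB ?bnd_simp//; last by lra.
apply: (bounded_integrable mg gM) => //.
by rewrite lebesgue_measure_itv/=; case: ifP => // _; rewrite -EFinB ltry.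
Unshelve. all: by end_near. Qed.

End lipschitz_ftc.

(** * Translation of Lebesgue integrals *)

Section lebesgue_shift.
Context {R : realType}.
Notation mu := (@lebesgue_measure R).
Variable c : R.
Let phi (x : measurableTypeR R) : measurableTypeR R := x - c.

Let mphi : measurable_fun [set: measurableTypeR R] phi.
Proof. exact: measurable_funB. Qed.

Lemma lebesgue_measure_shift (B : set (measurableTypeR R)) : measurable B ->
  mu (phi @^-1` B) = mu B.
Proof.
move=> mB; have mphi_mixin := isMeasurableFun.Build _ _ _ _ _ mphi.
pose mphi_pack : {mfun _ >-> _} := HB.pack phi mphi_mixin.
have := @lebesgue_measure_unique R (pushforward mu mphi_pack) _ B mB.
move=> -> // _ [[a b] _ <-] /=; rewrite /pushforward.
have -> : phi @^-1` `]a, b]%classic = `]a + c, b + c]%classic.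
  by apply/seteqP; split => x /=; rewrite /phi !in_itv/= ltrBrDr lerBlDr.
have := @lebesgue_measure_itv R `]a, b].
have := @lebesgue_measure_itv R `]a + c, b + c].
rewrite /= !lte_fin => -> ->; rewrite ltrD2r; case: ifP => // _.
by rewrite -!EFinB; congr EFin; ring.
Qed.

Variables (f : R -> R) (t : R).
Hypothesis intf : mu.-integrable `]0, t[ (EFin \o f).

Let ft := f \_ `]0, t[.

Let ft_shift : ft \o phi = (fun s => f (s - c)) \_ `]c, c + t[.
Proof.
apply/funext => s; rewrite /ft /phi /= !patchE.
have -> // : (s - c \in `]0, t[%classic) = (s \in `]c, c + t[%classic).
by rewrite !mem_setE !in_itv/= subr_gt0 ltrBlDl.
Qed.

Let ft_int : mu.-integrable [set: measurableTypeR R] (EFin \o ft).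
Proof. by rewrite -restrict_EFin; apply/integrable_restrict => //; rewrite setTI. Qed.

Let ft_phi_int : mu.-integrable [set: measurableTypeR R] (EFin \o (ft \o phi)).
Proof.
have /integrableP[mft foo] := ft_int.
apply/integrableP; split.
  apply/measurable_EFinP; apply: measurableT_comp => //.
  exact/measurable_EFinP.
move: foo; rewrite (eq_measure_integral (pushforward mu phi)); last first.
  by move=> B mB _; rewrite /pushforward -[LHS]lebesgue_measure_shift.
rewrite ge0_integral_pushforward ?preimage_setT//.
exact: measurableT_comp.
Qed.

Lemma integrable_shift :
  mu.-integrable `]c, c + t[ (fun s => (f (s - c))%:E).
Proof.
have := ft_phi_int; rewrite ft_shift -restrict_EFin => H.
by have /integrable_restrict := H; rewrite setTI; apply.
Qed.

Lemma Rintegral_shift :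
  \int[mu]_(s in `]c, c + t[) f (s - c) = \int[mu]_(s in `]0, t[) f s.
Proof.
rewrite /Rintegral; congr fine.
rewrite [LHS]integral_mkcond [RHS]integral_mkcond.
transitivity (\int[mu]_(x in setT) (EFin \o (ft \o phi)) x)%E.
  by rewrite ft_shift -restrict_EFin.
have /integrableP[mft _] := ft_int.
transitivity (\int[pushforward mu phi]_(x in setT) (EFin \o ft) x)%E.
  by rewrite integral_pushforward//; exact: ft_phi_int.
transitivity (\int[mu]_(x in setT) (EFin \o ft) x)%E.
  by apply: eq_measure_integral => B mB _; exact: lebesgue_measure_shift.
by rewrite /ft -restrict_EFin.
Qed.

End lebesgue_shift.

(** * Orbits of the semigroup *)

Section absolutely_continuous_misc.
Context {R : realType} {V : normedModType R}.

Lemma absolutely_continuous_norm_sub (f g : R -> V) (a b : R) :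
  absolutely_continuous_on a b f -> absolutely_continuous_on a b g ->
  absolutely_continuous_on a b (fun t => `|f t - g t| : R^o).
Proof.
move=> acf acg e e0; have e20 : 0 < e / 2 by rewrite divr_gt0.
have [d1 d10 H1] := acf _ e20; have [d2 d20 H2] := acg _ e20.
exists (Num.min d1 d2); first by rewrite lt_min d10.
move=> n l r lr dis; rewrite lt_min => /andP[s1 s2].
have {}H1 := H1 _ _ _ lr dis s1; have {}H2 := H2 _ _ _ lr dis s2.
apply: le_lt_trans (_ : _ <= \sum_(i < n) `|f (r i) - f (l i)| +
   \sum_(i < n) `|g (r i) - g (l i)|) _; last by lra.
rewrite -big_split/=; apply: ler_sum => i _.
apply: le_trans (ler_dist_dist _ _) _.
have -> : f (r i) - g (r i) - (f (l i) - g (l i)) =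
          f (r i) - f (l i) - (g (r i) - g (l i)).
  by rewrite !opprB !addrA [LHS](ACl (1*4*3*2))%AC.
exact: ler_normB.
Qed.

Lemma W11_ext (f g : R -> V) (a b : R) : (forall t, a <= t <= b -> f t = g t) ->
  W11 a b f -> W11 a b g.
Proof.
move=> fg [acf df]; split.
  move=> e e0; have [d d0 H] := acf e e0; exists d => // n l r lr dis s.
  apply: le_lt_trans (H n l r lr dis s); apply: ler_sum => i _.
  by have [? [? ?]] := lr i; rewrite !fg//; apply/andP; split => //; lra.
apply: negligibleS df => t /= nt dt; apply: nt => tab; have := dt tab.
apply: near_eq_derivable => //.
have oab : nbhs t `]a, b[%classic.
  by apply: open_nbhs_nbhs; split; [exact: interval_open|].
apply: filterS oab => s /=; rewrite in_itv/= => /andP[? ?]; apply: fg.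
by rewrite !ltW.
Qed.

End absolutely_continuous_misc.

(** * Countable separating families of functionals *)

Section countable_separation.
Context {R : realType} {V : normedModType R}.

Lemma countable_separating (Vstar : set {linear V -> R^o}) : separable V ->
  Vstar `<=` topological_dual -> separates_points Vstar -> Vstar !=set0 ->
  exists psi : nat -> nat -> {linear V -> R^o},
    (forall i j, Vstar (psi i j)) /\
    forall v, (forall i j, psi i j v = 0) -> v = 0.
Proof.
move=> /separable_sequence[q qP] dualV sepV [psi0 Vpsi0].
pose good i j (Psi : {linear V -> R^o}) :=
  Vstar Psi /\ forall w, `|w - q i| < j.+1%:R^-1 -> Psi w <> 0.
(* Where no functional is good for the ball, [psi0] fills the place. *)
have psiP i j : exists Psi, Vstar Psi /\ ((exists Psi', good i j Psi') -> good i j Psi).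
  have [[Psi' g']|ng] := pselect (exists Psi', good i j Psi').
    by exists Psi'; split => //; case: g'.
  by exists psi0.
(* If Psi v <> 0 then Psi does not vanish on some basic ball around v, and
   neither does the functional chosen for that ball. *)
pose psi i j := projT1 (cid (psiP i j)).
exists psi; split; first by move=> i j; rewrite /psi; case: cid => p [].
move=> v vP; apply: contrapT => v0.
have [Psi [VPsi Psiv]] : exists Psi, Vstar Psi /\ Psi v <> 0.
  apply: contrapT => nP; apply: v0; apply: sepV => Psi VPsi.
  by apply: contrapT => Pv; apply: nP; exists Psi.
have cPsi : Psi @ v --> Psi v by exact: dualV.
have [e e0 He] : exists2 e : R, 0 < e & forall w, `|w - v| < e -> Psi w <> 0.
  have Pv0 : 0 < `|Psi v| by rewrite normr_gt0; apply/eqP.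
  move/cvgrPdist_lt : cPsi => /(_ _ Pv0) /nbhs_normP[e e0 He].
  exists e => // w wv Pw0; have := He w; rewrite /= distrC => /(_ wv).
  by rewrite Pw0 subr0 ltxx.
have [j je] : exists j, (j.+1%:R^-1 : R) < e / 2.
  have : \forall n \near \oo, `|0 - n.+1%:R^-1 : R| < e / 2.
    by apply: cvgr_dist_lt; [exact: cvg_harmonic|rewrite divr_gt0].
  move=> [n _ /(_ n (leqnn n))] /=; rewrite sub0r normrN ger0_norm//.
  by exists n.
have [i vi] : exists i, `|v - q i| < j.+1%:R^-1 by apply: qP; rewrite invr_gt0.
have gij : exists Psi', good i j Psi'.
  exists Psi; split => // w wi; apply: He.
  apply: le_lt_trans (ler_distD (q i) w v) _.
  by rewrite (splitr e) (distrC (q i) v) ltrD// (lt_trans _ je).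
have := vP i j; rewrite /psi; case: cid => p /= [_ /(_ gij)[_ Hp]] pv0.
exact: (Hp v vi pv0).
Qed.

(** Lebesgue differentiation identifies each [psi i j] of the derivative of Y with
    [- psi i j (B t)], off one null set common to all i and j; separation then identifies the
    derivative itself. *)
Lemma derivative_of_weak_primitive (Y B : R -> V) (a b : R)
    (psi : nat -> nat -> {linear V -> R^o}) : a < b -> W11 a b Y ->
  (forall i j, continuous (psi i j)) ->
  (forall v, (forall i j, psi i j v = 0) -> v = 0) ->
  (forall i j, lebesgue_measure.-integrable `]a, b[ (EFin \o (psi i j \o B))) ->
  (forall i j t, a < t < b -> psi i j (Y t) - psi i j (Y a) =
    - \int[lebesgue_measure]_(s in `]a, t[) psi i j (B s)) ->
  exists2 E : set R, lebesgue_measure.-negligible E &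
    forall t, a < t < b -> ~ E t ->
      h^-1 *: (Y (t + h) - Y t) @[h --> 0^'] --> - B t.
Proof.
move=> ab [_ dY] cpsi sep int eqY.
pose mu := @lebesgue_measure R.
(* Extended by 0, since [FTC1] is applied to a function locally integrable on the whole line. *)
pose k i j := (psi i j \o B) \_ `]a, b[.
have intk i j (D : set (measurableTypeR R)) : measurable D -> mu.-integrable D (EFin \o k i j).
  move=> mD; apply: (@integrableS _ _ _ mu setT) => //.
  by rewrite -restrict_EFin; apply/integrable_restrict => //; rewrite setTI.
have loc i j : locally_integrable [set: R] (k i j).
  exact: integrable_locally_restrict.
have dk i j := @FTC1 _ (k i j) (BLeft a) (fun y => intk i j _ (measurable_itv _)) (loc i j).
pose F i j x := \int[mu]_(t in [set` Interval (BLeft a) (BRight x)]) k i j t.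
pose E i j := ~` [set x | a < x -> derivable (F i j) x 1 /\ derive1 (F i j) x = k i j x].
exists ((\bigcup_i \bigcup_j E i j) `|`
  ~` [set t | t \in `]a, b[ -> derivable (Y : R^o -> V) t 1]).
  apply: negligibleU => //.
  apply: negligible_bigcup => i; apply: negligible_bigcup => j.
  have [D [mD D0 HD]] := dk i j; exists D; split => //.
move=> t /andP[at_ tb] /not_orP[nE /contrapT/= dYt].
have {}dYt : derivable (Y : R^o -> V) t 1 by apply: dYt; rewrite in_itv/= at_.
have {}nE i j : derivable (F i j) t 1 /\ derive1 (F i j) t = psi i j (B t).
  have : ~ E i j t by move=> Et; apply: nE; exists i => //; exists j.
  move=> /contrapT /(_ at_) [? ->]; split => //.
  by rewrite /k patchE ifT// inE/= in_itv/= at_.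
have dq := derivable_difference_quotient dYt.
set l := 'D_1 _ t in dq; suff -> : - B t = l by [].
apply/eqP; rewrite eq_sym -subr_eq0 opprK; apply/eqP; apply: sep => i j.
rewrite linearD; apply/eqP; rewrite addr_eq0; apply/eqP.
have [dF F't] := nE i j.
have q1 : psi i j (h^-1 *: (Y (t + h) - Y t)) @[h --> 0^'] --> psi i j l.
  exact: (@cvg_comp _ _ _ _ (psi i j) _ _ _ dq (@cpsi i j l)).
have q2 : - (h^-1 *: (F i j (t + h) - F i j t : R^o)) @[h --> 0^'] --> (- psi i j (B t) : R^o).
  by apply: cvgN; rewrite -F't derive1E; exact: derivable_difference_quotient.
apply: (cvg_unique _ q1); first exact: norm_hausdorff.
apply: cvg_trans q2; apply: near_eq_cvg.
have FE x : a < x < b -> F i j x = \int[mu]_(s in `]a, x[) psi i j (B s).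
  move=> /andP[ax xb]; rewrite /F -Rintegral_itv_obnd_cbnd; last by exact: intk.
  rewrite -Rintegral_itv_bndo_bndc; last by exact: intk.
  apply: eq_Rintegral => s; rewrite inE/= in_itv/= => /andP[as_ sx].
  by rewrite /k patchE ifT// inE/= in_itv/= as_ (lt_trans sx).
near=> h.
have : `|h| < Num.min (t - a) (b - t).
  by near: h; apply: dnbhs0_lt; rewrite lt_min !subr_gt0 at_.
rewrite lt_min !ltr_norml => /andP[/andP[h1 _] /andP[_ h2]].
have th : a < t + h < b by apply/andP; split; lra.
rewrite -scalerN linearZ linearB /= !FE ?at_//; congr (_ *: _).
by have := eqY i j _ th; have := eqY i j t; rewrite at_ tb => /(_ isT); lra.
Unshelve. all: by end_near. Qed.

End countable_separation.

Section orbits.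
Context {R : realType} {V : normedModType R}.
Notation mu := (@lebesgue_measure R).
Variables (A : V -> set V) (T : R -> V -> V) (A0 : V -> V).
Hypothesis accA : accretive A.
Hypothesis denseA : densely_defined A.
Hypothesis TP : associated_semigroup A T.
Hypothesis T_domain : domain_invariant A T.
Hypothesis A0P : infinitesimal_generator A T A0.

(* For u in D(A) the constant extension to ]-oo, a] makes the orbit globally
   Lipschitz with a right derivative everywhere. *)
Definition stopped_orbit (a : R) (u : V) (t : R) := T (Num.max (t - a) 0) u.

Lemma stopped_orbitE a u t : a <= t -> stopped_orbit a u t = T (t - a) u.
Proof. by move=> at_; rewrite /stopped_orbit max_l// subr_ge0. Qed.

Lemma stopped_orbit_lipschitz a u : op_domain A u -> forall s t,
  `|stopped_orbit a u t - stopped_orbit a u s| <= `|A0 u| * `|t - s|.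
Proof.
move=> Du s t; have [_ AA0] := A0P.1 u Du.
have m0 (x : R) : 0 <= Num.max x 0 by rewrite le_max lexx orbT.
apply: le_trans (semigroup_lipschitz accA TP AA0 (m0 _) (m0 _)) _.
rewrite ler_wpM2l//; apply: le_trans (lipschitz_max0 _ _) _.
by rewrite opprB addrA subrK.
Qed.

Lemma stopped_orbit_right_derivative a u : op_domain A u -> forall t,
  h^-1 *: (stopped_orbit a u (t + h) - stopped_orbit a u t) @[h --> 0^'+] -->
    (if t < a then 0 else - A0 (T (t - a) u)).
Proof.
move=> Du t; case: ifPn => ta.
  have c0 : (0 : V) @[h --> (0 : R)^'+] --> (0 : V) by exact: cvg_cst.
  apply: cvg_trans c0; apply: near_eq_cvg; near=> h.
  have : h <= a - t by near: h; apply: nbhs_right_le; rewrite subr_gt0.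
  move=> ha; rewrite /stopped_orbit !max_r ?subrr ?scaler0//; lra.
rewrite -leNgt in ta; have ta0 : 0 <= t - a by rewrite subr_ge0.
have Dt : op_domain A (T (t - a) u).
  have [->|tna] := eqVneq t a; first by rewrite subrr (semigroup0 TP).
  by apply: T_domain; rewrite subr_gt0 lt_neqAle eq_sym tna.
apply: cvg_trans (semigroup_right_derivative accA denseA TP A0P ta0 Dt).
apply: near_eq_cvg; near=> h.
have h0 : 0 <= h by near: h; exact: nbhs_right_ge.
by rewrite !stopped_orbitE ?ler_wpDr// addrAC.
Unshelve. all: by end_near. Qed.

(** The orbit is restarted at a > c, where domain invariance has brought it into D(A); u itself need
    not lie there. *)
Lemma orbit_W11 c u a b : separable V -> c < a -> a < b ->
  W11 a b (fun t => T (t - c) u).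
Proof.
move=> sepV ca ab.
have Du : op_domain A (T (a - c) u) by apply: T_domain; rewrite subr_gt0.
apply: (@W11_ext _ _ (stopped_orbit a (T (a - c) u))).
  move=> t /andP[at_ _]; rewrite stopped_orbitE//.
  rewrite -(semigroupD accA denseA TP) ?subr_ge0 ?(ltW ca)//.
  by congr (T _ u); ring.
have fL := @stopped_orbit_lipschitz a _ Du.
have fg := @stopped_orbit_right_derivative a _ Du.
split.
  apply: (@lipschitz_absolutely_continuous _ _ _ `|A0 (T (a - c) u)|) => // s t _ st _.
  by apply: le_trans (fL _ _) _; rewrite ger0_norm ?subr_ge0.
have [E nE EP] := lipschitz_ae_derivative (normr_ge0 _) fL fg a sepV.
apply: negligibleS nE => t /= nt; apply: contrapT => Et; apply: nt.
rewrite in_itv/= => /andP[at_ _].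
by apply: difference_quotient_derivable; exact: EP.
Qed.

Lemma orbit_integral (Psi : {linear V -> R^o}) u r : continuous Psi -> 0 < r ->
  (forall t, 0 < t -> mu.-integrable `]0, t[ (fun s => (Psi (A0 (T s u)))%:E)) ->
  Psi (T r u) - Psi u = - \int[mu]_(s in `]0, r[) Psi (A0 (T s u)).
Proof.
(* Cut off at r + 1, so that [k] still agrees with the integrand at the endpoint r. *)
move=> cPsi r0 int; pose k := (fun s => Psi (A0 (T s u))) \_ `]0, r + 1[.
have r10 : 0 < r + 1 by lra.
have intk (D : set (measurableTypeR R)) : measurable D -> mu.-integrable D (EFin \o k).
  move=> mD; apply: (@integrableS _ _ _ mu setT) => //.
  by rewrite -restrict_EFin; apply/integrable_restrict => //; rewrite setTI; exact: int.
have kE s : 0 < s <= r -> k s = Psi (A0 (T s u)).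
  move=> /andP[s0 sr]; rewrite /k patchE ifT// inE/= in_itv/= s0/=; lra.
have -> : \int[mu]_(s in `]0, r[) Psi (A0 (T s u)) = \int[mu]_(s in `[0, r]) k s.
  rewrite -Rintegral_itv_obnd_cbnd; last exact: intk.
  rewrite -Rintegral_itv_bndo_bndc; last exact: intk.
  apply: eq_Rintegral => s; rewrite inE/= in_itv/= => /andP[s0 sr].
  by rewrite kE// s0 ltW.
(* The operator bound of Psi makes Psi along a restarted orbit Lipschitz, as [lipschitz_ftc]
   requires. *)
have [M M0 PM] : exists2 M : R, 0 <= M & forall v, `|Psi v| <= M * `|v|.
  have /linear_boundedP[M [Mr MP]] : bounded_near Psi (nbhs (0 : V)).
    by apply/linear_bounded_continuous.
  exists (`|M| + 1); first by rewrite addr_ge0.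
  by apply: MP; rewrite (le_lt_trans (ler_norm M))// ltrDl.
have ftc del : 0 < del < r ->
    Psi (T r u) - Psi (T del u) =
    - (\int[mu]_(s in `[0, r]) k s - \int[mu]_(s in `[0, del]) k s).
  move=> /andP[d0 dr].
  have Du : op_domain A (T del u) by exact: T_domain.
  rewrite Rintegral_itvB ?bnd_simp ?ltW//; last exact: intk.
  pose f t := Psi (stopped_orbit del (T del u) t) : R.
  pose g t := Psi (if t < del then 0 else - A0 (T (t - del) (T del u))) : R.
  have fL s t : `|f t - f s| <= (M * `|A0 (T del u)|) * `|t - s|.
    rewrite /f -linearB; apply: le_trans (PM _) _; rewrite -mulrA ler_wpM2l//.
    exact: stopped_orbit_lipschitz.
  have fg t : h^-1 *: (f (t + h) - f t : R^o) @[h --> 0^'+] --> (g t : R^o).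
    have := @cvg_comp _ _ _ _ Psi _ _ _ (@stopped_orbit_right_derivative del _ Du t) (@cPsi _).
    apply: cvg_trans; apply: near_eq_cvg; near=> h.
    by rewrite /= linearZ linearB.
  have MA0 : 0 <= M * `|A0 (T del u)| by rewrite mulr_ge0.
  have := lipschitz_ftc MA0 fL fg (ltW dr).
  rewrite /f !stopped_orbitE ?(ltW dr)// subrr (semigroup0 TP).
  rewrite -(semigroupD accA denseA TP) ?subr_ge0 ?(ltW dr) ?(ltW d0)// [del + _]addrC subrK => ->.
  rewrite -[RHS]mulN1r -RintegralZl//; last exact: intk.
  apply: eq_Rintegral => s; rewrite inE/= in_itv/= => /andP[ds sr].
  rewrite kE ?sr ?(lt_trans d0)// mulN1r /g ltNge (ltW ds)/= linearN.
  rewrite -(semigroupD accA denseA TP) ?subr_ge0 ?(ltW ds) ?(ltW d0)//.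
  by rewrite [del + _]addrC subrK.
apply/eqP; rewrite -subr_eq0 -normr_le0; apply/ler_addgt0Pr => e e0; rewrite add0r.
have e20 : 0 < e / 2 by rewrite divr_gt0.
have near1 := parameterized_integral_near_left r0 e20 (intk _ (measurable_itv `[0, r])).
have cT : Psi (T (Num.max t 0) u) @[t --> (0 : R)] --> Psi u.
  have := @cvg_comp _ _ _ _ Psi _ _ _
    (@semigroup_continuous _ _ _ _ accA denseA TP u 0) (@cPsi _).
  by rewrite maxxx (semigroup0 TP).
move/cvgrPdist_lt : cT => /(_ _ e20) near2.
near (0 : R)^'+ => del.
have d0 : 0 < del by near: del; exact: nbhs_right_gt.
have dr : del < r by near: del; exact: nbhs_right_lt.
have N1 : 0 <= del -> `|parameterized_integral mu 0 del k| < e / 2.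
  by near: del; apply: (@cvg_at_right_filter _ _ id); [exact: cvg_id|exact: near1].
have N2 : `|Psi u - Psi (T (Num.max del 0) u)| < e / 2.
  by near: del; apply: (@cvg_at_right_filter _ _ id); [exact: cvg_id|exact: near2].
have {}N1 := N1 (ltW d0); rewrite max_l ?(ltW d0)// in N2.
have dd : 0 < del < r by rewrite d0.
have := ftc _ dd; rewrite /parameterized_integral in N1.
move: N1 N2; rewrite !ltr_norml ler_norml => /andP[? ?] /andP[? ?] ?.
by apply/andP; split; lra.
Unshelve. all: by end_near. Qed.

Lemma orbit_unique (Y : R -> V) (a b : R) (E : set R) : a <= b ->
  absolutely_continuous_on a b Y -> (forall t, a <= t < b -> op_domain A (Y t)) ->
  mu.-negligible E ->
  (forall t, a < t < b -> ~ E t ->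
    h^-1 *: (Y (t + h) - Y t) @[h --> 0^'] --> - A0 (Y t)) ->
  Y b = T (b - a) (Y a).
Proof.
move=> ab acY DY nE dY.
have [<-|ab'] := eqVneq a b; first by rewrite subrr (semigroup0 TP).
have Da : op_domain A (Y a) by apply: DY; rewrite lexx lt_neqAle ab'.
pose W := stopped_orbit a (Y a).
have acW : absolutely_continuous_on a b W.
  apply: (@lipschitz_absolutely_continuous _ _ _ `|A0 (Y a)|) => // s t _ st _.
  by apply: le_trans (@stopped_orbit_lipschitz a _ Da _ _) _; rewrite ger0_norm ?subr_ge0.
(* The endpoint a, where the differential equation is not assumed, joins the exceptional set. *)
have n1 : mu.-negligible [set a].
  by exists [set a]; split => //; exact: lebesgue_measure_set1.
have := absolutely_continuous_right_dini_le0 ab (absolutely_continuous_norm_sub acY acW)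
  (negligibleU n1 nE) _.
rewrite /W !stopped_orbitE// subrr (semigroup0 TP) subrr normr0 normr_le0 subr_eq0 => H.
apply/eqP; apply: H => t tab /not_orP[nta nEt] e e0.
have at_ : a < t.
  by move/andP : tab => [at_ _]; rewrite lt_neqAle at_ andbT eq_sym; apply/eqP.
have e20 : 0 < e / 2 by rewrite divr_gt0.
have tb : t < b by case/andP : tab.
have dYt := right_derivative_near e20
  (cvg_dnbhs_at_right (dY t (introT andP (conj at_ tb)) nEt)).
have Dt : op_domain A (T 0 (Y t)) by rewrite (semigroup0 TP); exact: DY.
have dT := semigroup_right_derivative accA denseA TP A0P (lexx 0) Dt.
have {}dT := @right_derivative_near _ _ (fun s => T s (Y t)) 0 _ _ e20 dT.
near=> h.
have h0 : 0 <= h by near: h; exact: nbhs_right_ge.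
have A1 : `|Y (t + h) - Y t - h *: - A0 (Y t)| <= e / 2 * h by near: h.
have A2 : `|T (0 + h) (Y t) - T 0 (Y t) - h *: - A0 (T 0 (Y t))| <= e / 2 * h by near: h.
rewrite add0r !(semigroup0 TP) in A2.
have ath : a <= t + h by lra.
rewrite !stopped_orbitE ?(ltW at_)// (_ : t + h - a = t - a + h); last by ring.
rewrite (semigroupD accA denseA TP) ?subr_ge0 ?(ltW at_)//.
have C := semigroup_contraction accA denseA TP (Y t) (T (t - a) (Y a)) h0.
have := ler_distD (T h (Y t)) (Y (t + h)) (T h (T (t - a) (Y a))).
have : `|Y (t + h) - T h (Y t)| <= e / 2 * h + e / 2 * h.
  rewrite (_ : Y (t + h) - T h (Y t) = (Y (t + h) - Y t - h *: - A0 (Y t)) -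
    (T h (Y t) - Y t - h *: - A0 (Y t))).
    by apply: le_trans (ler_normB _ _) _; exact: lerD.
  by rewrite opprB addrA subrK opprB addrA subrK.
lra.
Unshelve. all: by end_near. Qed.

(** Lets s tend to a from the right: a strong solution is absolutely continuous only on compact
    intervals strictly between hitting times, and its value at a hitting time may lie outside
    D(A). *)
Lemma orbit_unique_right (Y : R -> V) (a b : R) :
  Y s @[s --> a^'+] --> Y a ->
  (forall s t, a < s -> s <= t -> t < b -> Y t = T (t - s) (Y s)) ->
  forall t, a <= t < b -> Y t = T (t - a) (Y a).
Proof.
move=> cY YT t /andP[at_ tb].
have [->|tna] := eqVneq t a; first by rewrite subrr (semigroup0 TP).
have {}at_ : a < t by rewrite lt_neqAle eq_sym tna.
apply/eqP; rewrite -subr_eq0 -normr_le0; apply/ler_addgt0Pr => e e0; rewrite add0r.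
have e20 : 0 < e / 2 by rewrite divr_gt0.
move/cvgrPdist_le : cY => /(_ _ e20) near1.
have cT : T (Num.max (t - s) 0) (Y a) @[s --> a] --> T (Num.max (t - a) 0) (Y a).
  apply: (@continuous_comp _ _ _ (fun s : R => t - s) (fun s => T (Num.max s 0) (Y a))).
    by apply: cvgB; [exact: cvg_cst|exact: cvg_id].
  exact: (@semigroup_continuous _ _ _ _ accA denseA TP).
move/cvgrPdist_le : cT => /(_ _ e20) near2.
near a^'+ => s.
have as_ : a < s by near: s; exact: nbhs_right_gt.
have st : s < t by near: s; exact: nbhs_right_lt.
have N1 : `|Y a - Y s| <= e / 2 by near: s.
have N2 : `|T (Num.max (t - a) 0) (Y a) - T (Num.max (t - s) 0) (Y a)| <= e / 2.
  by near: s; apply: (@cvg_at_right_filter _ _ id); [exact: cvg_id|exact: near2].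
rewrite !max_l ?subr_ge0 ?(ltW st) ?(ltW at_)// in N2.
rewrite (YT s t as_ (ltW st) tb).
have ts0 : 0 <= t - s by rewrite subr_ge0 ltW.
have := semigroup_contraction accA denseA TP (Y s) (Y a) ts0.
have := ler_distD (T (t - s) (Y a)) (T (t - s) (Y s)) (T (t - a) (Y a)).
rewrite (distrC (Y s)) (distrC (T (t - s) (Y a)) (T (t - a) _)); lra.
Unshelve. all: by end_near. Qed.

End orbits.

(** * Borel measurability in separable spaces *)

Section completeness.
Context {R : realType} {d : measure_display} {Om : measurableType d}.
Variable P : {measure set Om -> \bar R}.
Hypothesis cP : measure_is_complete P.

Lemma complete_measurable_set (B C : set Om) :
  measurable B -> {ae P, forall w, B w <-> C w} -> measurable C.
Proof.
move=> mB BC; pose N := ~` [set w | B w <-> C w].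
have nN : P.-negligible N by exact: BC.
have mN : measurable N by exact: cP.
have -> : C = (B `\` N) `|` (C `&` N).
  apply/seteqP; split => w.
    by move=> Cw; have [Nw|/contrapT Nw] := pselect (N w); [right|left; split; [apply/Nw|]].
  by move=> [[Bw /contrapT Nw]|[]//]; apply/Nw.
apply: measurableU; first exact: measurableD.
by apply: cP; apply: negligibleS nN => w [].
Qed.

Lemma complete_measurable_fun d' (S : measurableType d') (f g : Om -> S) :
  measurable_fun setT f -> {ae P, forall w, f w = g w} -> measurable_fun setT g.
Proof.
move=> mf fg _ Y mY; rewrite setTI.
apply: (@complete_measurable_set (f @^-1` Y)).
  by rewrite -[X in measurable X]setTI; exact: mf.
by move: fg; apply: negligibleS => w /= nw fw; apply: nw; rewrite /preimage/= fw.
Qed.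

End completeness.

Section borel.
Context {R : realType} {V : completeNormedModType R}.
Context {d : measure_display} {S : measurableType d}.
Variable D : set S.
Hypothesis mD : measurable D.
Hypothesis sepV : separable V.
Implicit Types f g : S -> borelType V.

Lemma open_measurable_borel (O' : set V) : open O' -> measurable (O' : set (borelType V)).
Proof. by move=> oO; exact: sub_gen_smallest. Qed.

Lemma measurable_fun_open f : (forall O' : set V, open O' -> measurable (D `&` f @^-1` O')) ->
  measurable_fun D f.
Proof.
move=> H; apply: (@measurability _ _ _ _ D f (@open V)) => //.
by move=> _ [B oB <-]; exact: H.
Qed.

Lemma measurable_fun_dist f q : measurable_fun D f ->
  measurable_fun D (fun s => `|(f s : V) - q|).
Proof.
move=> mf; apply: (@measurability _ _ S R D _ (@RGenOInfty.G R)).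
  exact: RGenOInfty.measurableE.
move=> _ [_ [x ->] <-].
rewrite (_ : _ @^-1` _ = f @^-1` [set v : V | x < `|v - q|]); last first.
  by apply/seteqP; split => s /=; rewrite in_itv/= andbT.
apply: mf => //; apply: open_measurable_borel.
apply: (@open_comp _ _ (fun v : V => `|v - q|) [set y | x < y]); last exact: open_gt.
move=> v _; apply: cvg_norm; apply: cvgB; [exact: cvg_id|exact: cvg_cst].
Qed.

(** Every open set is a countable union of balls of radius 1 / (k + 1) around points q n, so the
    distances to the q n decide Borel measurability. *)
Lemma measurable_fun_dense f (q : nat -> V) :
  (forall v (e : R), 0 < e -> exists n, `|v - q n| < e) ->
  (forall n, measurable_fun D (fun s => `|(f s : V) - q n|)) -> measurable_fun D f.
Proof.
move=> qP mf; apply: measurable_fun_open => B oB.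
pose G n k := [set s | `|(f s : V) - q n| < k.+1%:R^-1].
pose good n k := forall v, `|v - q n| < k.+1%:R^-1 -> B v.
rewrite (_ : D `&` f @^-1` B = \bigcup_n \bigcup_(k in good n) (D `&` G n k)).
  apply: bigcup_measurable => n _; apply: bigcup_measurable => k _.
  rewrite (_ : G n k = (fun s => `|(f s : V) - q n|) @^-1` `]-oo, k.+1%:R^-1[).
    exact: mf.
  by apply/seteqP; split => s /=; rewrite in_itv.
apply/seteqP; split => s; last first.
  by move=> [n _ [k gk [Ds Gs]]]; split => //; exact: gk.
move=> [Ds /= Bs]; have /nbhs_normP[e e0 He] : nbhs (f s : V) B by exact: open_nbhs_nbhs.
have e20 : 0 < e / 2 by rewrite divr_gt0.
have [k ke] : exists k, (k.+1%:R^-1 : R) < e / 2.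
  have : \forall n \near \oo, `|0 - n.+1%:R^-1 : R| < e / 2.
    by apply: cvgr_dist_lt => //; exact: cvg_harmonic.
  move=> [n _ /(_ n (leqnn n))] /=; rewrite sub0r normrN ger0_norm//.
  by exists n.
have [|n fn] := qP (f s) (k.+1%:R^-1); first by rewrite invr_gt0.
exists n => //; exists k => // v vn; apply: He => /=.
apply: le_lt_trans (ler_distD (q n) (f s) v) _.
by rewrite (splitr e) ltrD ?(lt_trans _ ke)// distrC.
Qed.

(** By separability and continuity of addition, membership of f s + g s in an open set is a
    countable union of conditions on f s and g s separately. *)
Lemma measurable_funD_borel f g : measurable_fun D f -> measurable_fun D g ->
  measurable_fun D (fun s => (f s : V) + g s : borelType V).
Proof.
move=> mf mg; have [q qP] := separable_sequence sepV.
apply: measurable_fun_open => B oB.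
pose G i j k := [set s | `|(f s : V) - q i| < k.+1%:R^-1] `&`
  [set s | `|(g s : V) - q j| < k.+1%:R^-1].
pose good i j k := forall v w, `|v - q i| < k.+1%:R^-1 -> `|w - q j| < k.+1%:R^-1 -> B (v + w).
rewrite (_ : _ `&` _ = \bigcup_i \bigcup_j \bigcup_(k in good i j) (D `&` G i j k)).
  apply: bigcup_measurable => i _; apply: bigcup_measurable => j _.
  apply: bigcup_measurable => k _; rewrite /G setIIr.
  have H (h : S -> borelType V) (n : nat) : measurable_fun D h ->
      measurable (D `&` [set s | `|(h s : V) - q n| < k.+1%:R^-1]).
    move=> mh; rewrite (_ : [set s | _] = (fun s => `|(h s : V) - q n|) @^-1` `]-oo, k.+1%:R^-1[).
      exact: measurable_fun_dist.
    by apply/seteqP; split => s /=; rewrite in_itv.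
  by apply: measurableI; exact: H.
apply/seteqP; split => s; last first.
  by move=> [i _ [j _ [k gk [Ds [Gf Gg]]]]]; split => //; exact: gk.
move=> [Ds /= Bs]; have /nbhs_normP[e e0 He] : nbhs ((f s : V) + g s) B by exact: open_nbhs_nbhs.
have e40 : 0 < e / 4 by rewrite divr_gt0.
have [k ke] : exists k, (k.+1%:R^-1 : R) < e / 4.
  have : \forall n \near \oo, `|0 - n.+1%:R^-1 : R| < e / 4.
    by apply: cvgr_dist_lt => //; exact: cvg_harmonic.
  move=> [n _ /(_ n (leqnn n))] /=; rewrite sub0r normrN ger0_norm//.
  by exists n.
have k0 : 0 < (k.+1%:R^-1 : R) by rewrite invr_gt0.
have [i fi] := qP (f s) _ k0; have [j gj] := qP (g s) _ k0.
exists i => //; exists j => //; exists k => // v w vi wj; apply: He => /=.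
have -> : (f s : V) + g s - (v + w) = ((f s : V) - v) + ((g s : V) - w).
  by rewrite opprD addrACA.
apply: le_lt_trans (ler_normD _ _) _.
have := ler_distD (q i) (f s : V) v; have := ler_distD (q j) (g s : V) w.
rewrite (distrC (q i) v) (distrC (q j) w).
move: ke fi gj vi wj; move: (k.+1%:R^-1) => c; lra.
Qed.

Lemma measurable_sum_borel (f_ : nat -> S -> borelType V) n :
  (forall k, measurable_fun D (f_ k)) ->
  measurable_fun D (fun s => \sum_(0 <= k < n) (f_ k s : V) : borelType V).
Proof.
move=> mf; elim: n => [|n IH].
  rewrite (_ : (fun s => _) = (fun=> (0 : V))); first exact: measurable_cst.
  by apply/funext => s; rewrite big_geq.
rewrite (_ : (fun s => _) = (fun s => \sum_(0 <= k < n) (f_ k s : V) + f_ n s)).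
  exact: measurable_funD_borel.
by apply/funext => s; rewrite big_nat_recr.
Qed.

(** [limn] returns the default [point] where the sequence diverges, so the set C of convergence has
    to be measurable too; on C the distances of the limit to the q n are limits of real
    functions. *)
Lemma measurable_fun_lim_borel (f_ : nat -> S -> borelType V) :
  (forall k, measurable_fun D (f_ k)) ->
  measurable_fun D (fun s => limn (fun n => f_ n s : V) : borelType V).
Proof.
move=> mf; have [q qP] := separable_sequence sepV.
pose G k n m := [set s | `|(f_ m s : V) - q n| < k.+1%:R^-1].
pose C := [set s | cvg ((fun n => f_ n s : V) @ \oo)].
have mG k n m : measurable (D `&` G k n m).
  rewrite (_ : G k n m = (fun s => `|(f_ m s : V) - q n|) @^-1` `]-oo, k.+1%:R^-1[).
    exact: measurable_fun_dist.
  by apply/seteqP; split => s /=; rewrite in_itv.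
(* The Cauchy criterion with centres in the dense sequence; completeness of V gives the inclusion
   from right to left. *)
have CE : D `&` C = D `&` \bigcap_k \bigcup_n \bigcup_N
    \bigcap_(m in [set m | (N <= m)%N]) (D `&` G k n m).
  apply/seteqP; split => s [Ds Cs]; split => //.
    move=> k _; have k20 : 0 < (k.+1%:R^-1 : R) / 2 by rewrite divr_gt0// invr_gt0.
    have [n ln] := qP (limn (fun n => f_ n s : V)) _ k20.
    exists n => //; move/cvgrPdist_lt : (Cs : cvg _) => /(_ _ k20)[N _ HN].
    exists N => // m /= Nm; split => //; rewrite /G/=.
    apply: le_lt_trans (ler_distD (limn (fun n => f_ n s : V)) _ _) _.
    by rewrite [ltRHS]splitr ltrD// distrC; exact: HN.
  apply/cauchy_cvgP/cauchy_exP => e e0.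
  have [k ke] : exists k, (k.+1%:R^-1 : R) < e.
    have : \forall n \near \oo, `|0 - n.+1%:R^-1 : R| < e.
      by apply: cvgr_dist_lt => //; exact: cvg_harmonic.
    move=> [n _ /(_ n (leqnn n))] /=; rewrite sub0r normrN ger0_norm//.
    by exists n.
  have [n _ [N _ HN]] := Cs k I; exists (q n); exists N => // m /= Nm.
  have [_ Gs] := HN m Nm; rewrite -ball_normE/= distrC.
  exact: lt_trans ke.
have mC : measurable (D `&` C).
  rewrite CE; apply: measurableI => //; apply: bigcapT_measurable => k.
  apply: bigcup_measurable => n _; apply: bigcup_measurable => N _.
  by apply: bigcap_measurable; [exists N => /=|move=> m _; exact: mG].
apply: (measurable_fun_dense qP) => n.
have -> : (fun s => `|limn (fun n => f_ n s : V) - q n|) =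
    (fun s => if s \in C then limn (fun m => `|(f_ m s : V) - q n|) else `|(point : V) - q n|).
  apply/funext => s; case: ifPn => [|]; rewrite ?(inE,notin_setE)/= => Cs.
    apply/esym/cvg_lim; first exact: Rhausdorff.
    by apply: cvg_norm; apply: cvgB => //; exact: cvg_cst.
  by rewrite dvgP.
move=> _ Y mY.
rewrite (_ : _ `&` _ = ((D `&` C) `&` (fun s => limn (fun m => `|(f_ m s : V) - q n|)) @^-1` Y)
  `|` ((D `\` (D `&` C)) `&` (fun=> `|(point : V) - q n|) @^-1` Y)); last first.
  apply/seteqP; split => s.
    by move=> [Ds] /=; case: ifPn => [|]; rewrite ?(inE,notin_setE)/= => Cs Ys; [left|right; split => //; split => // -[]].
  by move=> [[[Ds Cs]]|[[Ds nC]]] /= Ys; split => //=; [rewrite mem_set|rewrite memNset// => Cs; apply: nC].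
apply: measurableU.
  apply: (@measurable_fun_cvg _ _ _ (D `&` C) (fun m s => `|(f_ m s : V) - q n|)) => //.
    by move=> m; apply: (measurable_funS mD); [exact: subIsetl|exact: measurable_fun_dist].
  move=> s [_ Cs]; apply: cvgP; apply: cvg_norm; apply: cvgB; [exact: Cs|exact: cvg_cst].
by apply: measurable_cst => //; exact: measurableD.
Qed.

(** A Caratheodory argument: rounding r down to the grid of mesh 1 / (n + 1) leaves countably many
    continuous maps [F t], and continuity in time gives the limit. *)
Lemma measurable_semigroup_comp (F : R -> V -> V) (r : S -> R) (y : S -> borelType V) :
  (forall t v, 0 <= t -> {for v, continuous (F t)}) ->
  (forall v, continuous (fun t : R => F (Num.max t 0) v : V)) ->
  (forall s, 0 <= r s) -> measurable_fun D r -> measurable_fun D y ->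
  measurable_fun D (fun s => F (r s) (y s) : borelType V).
Proof.
move=> cF cT r0 mr my; have [q qP] := separable_sequence sepV.
pose rn n s := (Num.truncn (n.+1%:R * r s))%:R / n.+1%:R : R.
pose f_ n s := F (rn n s) (y s) : borelType V.
have mf_ n : measurable_fun D (f_ n).
  apply: measurable_fun_open => B oB.
  rewrite (_ : _ `&` _ = \bigcup_k ((D `&` r @^-1` `[k%:R / n.+1%:R, k.+1%:R / n.+1%:R[) `&`
     (D `&` y @^-1` (F (k%:R / n.+1%:R) @^-1` B)))).
    apply: bigcup_measurable => k _; apply: measurableI; first exact: mr.
    apply: my => //; apply: open_measurable_borel.
    apply: open_comp => // v _; apply: cF; rewrite divr_ge0//.
  have tE s k : (k%:R / n.+1%:R <= r s < k.+1%:R / n.+1%:R) = (Num.truncn (n.+1%:R * r s) == k).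
    by rewrite truncn_eq ?mulr_ge0// ler_pdivrMr// ltr_pdivlMr// mulrC.
  apply/seteqP; split => s.
    move=> [Ds Bs]; exists (Num.truncn (n.+1%:R * r s)) => //; split; split => //=.
    by rewrite in_itv/= tE.
  by move=> [k _ [[Ds /=]]]; rewrite in_itv/= tE => /eqP <- [_]; split.
have f_cvg s : (fun n => f_ n s : V) @ \oo --> F (r s) (y s).
  rewrite -[in F (r s)](max_l (r0 s)).
  have -> : (fun n => f_ n s : V) = (fun n => F (Num.max (rn n s) 0) (y s)).
    by apply/funext => n; rewrite max_l// divr_ge0.
  apply: (@cvg_comp _ _ _ (fun n => rn n s) (fun t => F (Num.max t 0) (y s)) _
    (nbhs (r s))); last exact: cT.
  apply/cvgrPdist_le => e e0.
  have : \forall n \near \oo, `|0 - n.+1%:R^-1 : R| < e.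
    by apply: cvgr_dist_lt => //; exact: cvg_harmonic.
  apply: filterS => n; rewrite sub0r normrN ger0_norm// => ne; apply: le_trans (ltW ne).
  have := truncn_itv (mulr_ge0 (ler0n R n.+1) (r0 s)); rewrite /rn.
  set k := Num.truncn _; rewrite -[k.+1%:R]natr1 => /andP[k1 k2].
  have n0 : 0 < (n.+1%:R : R) by [].
  rewrite -(ler_pM2r n0) mulVf ?gt_eqF// -[X in _ * X](gtr0_norm n0) -normrM mulrBl mulfVK ?gt_eqF//.
  by rewrite ler_norml mulrC; apply/andP; split; lra.
apply: (measurable_fun_dense qP) => n.
apply: (@measurable_fun_cvg _ _ _ D (fun m s => `|(f_ m s : V) - q n|)).
  by move=> m; exact: measurable_fun_dist.
by move=> s _; apply: cvg_norm; apply: cvgB; [exact: f_cvg|exact: cvg_cst].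
Qed.

End borel.

(** * Hitting times and the counting measure *)

Section increasing_times.
Context {R : realType}.
Variable al : nat -> R.
Hypothesis al_lt : forall m, al m < al m.+1.

Lemma times_lt i j : (i < j)%N -> al i < al j.
Proof.
elim: j => // j IH; rewrite ltnS leq_eqVlt => /predU1P[->//|/IH ij].
exact: lt_trans (al_lt j).
Qed.

Lemma times_le i j : (i <= j)%N -> al i <= al j.
Proof. by rewrite leq_eqVlt => /predU1P[->//|/times_lt/ltW]. Qed.

Lemma times_lt_inv i j : al i < al j -> (i < j)%N.
Proof. by move=> aij; rewrite ltnNge; apply/negP => /times_le; rewrite leNgt aij. Qed.

Lemma times_bracket_uniq t i j : al i <= t < al i.+1 -> al j <= t < al j.+1 -> i = j.
Proof.
move=> /andP[i1 i2] /andP[j1 j2].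
have ij := times_lt_inv (le_lt_trans i1 j2).
have ji := times_lt_inv (le_lt_trans j1 i2).
by apply/eqP; rewrite eqn_leq -ltnS ij -ltnS.
Qed.

Lemma times_bracket t : al 0 <= t -> (exists m, t < al m) ->
  exists m, al m <= t < al m.+1.
Proof.
move=> t0 ex; case: (ex_minnP ex) => -[|m] tm mmin; first by lra.
by exists m; rewrite tm andbT leNgt; apply/negP => /mmin; rewrite ltnn.
Qed.

End increasing_times.

Section counting.
Context {R : realType} {d : measure_display} {Z : measurableType d}.
Variables (theta : point_function R Z) (al : nat -> R).
Hypothesis al0 : al 0 = 0.
Hypothesis al_lt : forall m, al m < al m.+1.
Hypothesis dom_theta : point_dom theta = range (fun m => al m.+1).
Implicit Types (U : set (measurableTypeR R * Z)).

(* The value [point] off the domain of [theta] is never used. *)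
Definition mark (m : nat) : Z := odflt point (theta (al m)).

Lemma theta_mark m : theta (al m.+1) = Some (mark m.+1).
Proof.
have : point_dom theta (al m.+1) by rewrite dom_theta; exists m.
by rewrite /point_dom /mark /=; case: (theta _).
Qed.

Lemma hits_mark U t : hits theta U t <-> exists2 m, t = al m.+1 & U (al m.+1, mark m.+1).
Proof.
split => [[z tz Utz]|[m -> Um]]; last by exists (mark m.+1); rewrite ?theta_mark.
have : point_dom theta t by rewrite /point_dom/= tz.
rewrite dom_theta => -[m _ mt]; exists m => //.
by move: tz; rewrite -mt theta_mark => -[->]; rewrite mt.
Qed.

Lemma measurable_real_set1 (a : R) : measurable ([set a] : set (measurableTypeR R)).
Proof. exact: measurable_set1. Qed.

(** Only the first m marked points lie at or before t, and each contributes one Dirac mass;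
    integrals over []0, t]] thereby become finite sums. *)
Lemma counting_measure_before t m U : al m <= t < al m.+1 -> measurable U ->
  U `<=` `]0, t] `*` [set: Z] ->
  counting_measure theta U =
    (\sum_(k < m) \d_((al k.+1 : measurableTypeR R), mark k.+1) U)%E.
Proof.
move=> mt mU Ut.
pose B k : set (measurableTypeR R * Z) := [set al k.+1] `*` setT.
have mB k : measurable (B k) by apply: measurableX => //; exact: measurable_real_set1.
(* Generalized to sets that only the first n marked points can hit; the induction splits off the
   slice over [al n.+1], which holds at most one hit. *)
have key n (W : set (measurableTypeR R * Z)) : measurable W ->
   (forall k, W (al k.+1, mark k.+1) -> (k < n)%N) ->
   counting_measure theta W =
    (\sum_(k < n) \d_((al k.+1 : measurableTypeR R), mark k.+1) W)%E.
  elim: n W => [|n IH] W mW Wn.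
    rewrite big_ord0 /counting_measure (_ : hits theta W = set0).
      exact: (measure0 (@counting (measurableTypeR R) R)).
    by apply/seteqP; split => // s /hits_mark[k _ /Wn].
  rewrite big_ord_recr/= [LHS](@measureDI _ _ _ (counting_measure theta) W (B n))//.
  have mWB : measurable (W `\` B n) by exact: (measurableD mW (mB n)).
  have eWB k : (k < n)%N -> (W `\` B n) (al k.+1, mark k.+1) = W (al k.+1, mark k.+1).
    move=> kn; apply/propext; split => [[]//|Wk]; split => //.
    move=> -[/= akn _].
    have kn1 : (k.+1 < n.+1)%N by [].
    have := times_lt al_lt kn1.
    by rewrite akn ltxx.
  congr (_ + _)%E.
    apply: etrans (IH _ mWB _) _.
      move=> k [Wk nBk]; have := Wn k Wk; rewrite ltnS leq_eqVlt => /predU1P[kn|//].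
      by exfalso; apply: nBk; rewrite kn.
    by apply: eq_bigr => k _; rewrite !diracE; congr ((_ : bool)%:R%:E);
       apply/idP/idP; rewrite !inE eWB.
  change (@counting (measurableTypeR R) R (hits theta (W `&` B n)) =
    \d_((al n.+1 : measurableTypeR R), mark n.+1) W).
  rewrite diracE; have [Wm|nWm] := pselect (W (al n.+1, mark n.+1)).
    rewrite mem_set//= (_ : hits theta _ = [set al n.+1]).
      by rewrite /counting asboolT ?finite_set1// fset_set1 finmap.cardfs1.
    apply/seteqP; split => s; first by move=> /hits_mark[k -> [_ []]].
    by move=> ->; apply/hits_mark; exists n.
  rewrite memNset// (_ : hits theta _ = set0).
    exact: (measure0 (@counting (measurableTypeR R) R)).
  apply/seteqP; split => // s /hits_mark[k _ [Wk [/= akn _]]]; apply: nWm.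
  suff <- : k = n by [].
  have kk : al k.+1 <= al k.+1 < al k.+2 by rewrite lexx al_lt.
  have nn : al n.+1 <= al k.+1 < al n.+2 by rewrite akn lexx al_lt.
  by have [] := times_bracket_uniq al_lt kk nn.
apply: key => // k /Ut[] /=; rewrite in_itv/= => /andP[_ kt] _.
by have := times_lt_inv al_lt (le_lt_trans kt (proj2 (andP mt))).
Qed.

Lemma Rintegral_counting t m (f : measurableTypeR R * Z -> R) : al m <= t < al m.+1 ->
  measurable_fun (`]0, t] `*` [set: Z] : set (measurableTypeR R * Z)) f ->
  \int[counting_measure theta]_(p in `]0%R, t] `*` [set: Z]) f p =
    \sum_(k < m) f (al k.+1, mark k.+1).
Proof.
move=> mt mf; set D := (X in Rintegral _ X _).
have mD : measurable (D : set (measurableTypeR R * Z)) by exact: measurableX.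
pose m_ k : {measure set (measurableTypeR R * Z) -> \bar R} :=
  \d_((al k.+1 : measurableTypeR R), mark k.+1).
have Din k : (k < m)%N -> D (al k.+1, mark k.+1).
  move=> km; split => //=; rewrite in_itv/= -al0 (times_lt al_lt)//=.
  by case/andP : mt => mt _; exact: le_trans (times_le al_lt km) mt.
(* The nonnegative case, applied below to the positive and negative parts of f, whose integrals are
   finite sums. *)
have E (g : measurableTypeR R * Z -> R) : measurable_fun D g -> (forall p, 0 <= g p) ->
    (\int[counting_measure theta]_(p in D) (g p)%:E =
     (\sum_(k < m) g (al k.+1, mark k.+1))%:E)%E.
  move=> mg g0; transitivity (\int[msum m_ m]_(p in D) (g p)%:E)%E.
    by apply: eq_measure_integral => B mB BD; exact: counting_measure_before BD.
  rewrite ge0_integral_measure_sum//; last 2 first.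
    by move=> p _; rewrite lee_fin.
    exact/measurable_EFinP.
  rewrite -sumEFin; apply: eq_bigr => k _.
  rewrite integral_dirac//; last exact/measurable_EFinP.
  by rewrite diracE mem_set ?mul1e//; apply: Din.
rewrite /Rintegral integralE.
rewrite (_ : (fun x => (f x)%:E)^\+%E = EFin \o f^\+); last exact: funerpos.
rewrite (_ : (fun x => (f x)%:E)^\-%E = EFin \o f^\-); last exact: funerneg.
have Ep := E f^\+ (measurable_funrpos mf) (fun p => funrpos_ge0 f p).
have En := E f^\- (measurable_funrneg mf) (fun p => funrneg_ge0 f p).
rewrite Ep En.
rewrite -EFinB/= -sumrB; apply: eq_bigr => k _.
by have /(congr1 (fun g => g (al k.+1, mark k.+1))) := funrposBneg f.
Qed.

End counting.

Section point_process_times.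
Context {R : realType} {d d' : measure_display} {Om : measurableType d}.
Context (P : probability Om R) {Z : measurableType d'}.
Variables (Theta : Om -> point_function R Z) (alpha : nat -> Om -> R).
Hypothesis cP : measure_is_complete P.
Hypothesis Theta_finite : finite_point_process P Theta.
Hypothesis alphaP : hitting_times P Theta alpha.
Hypothesis Theta_infinite : {ae P, forall w, infinite_set (point_dom (Theta w))}.

Let measurable_hits k (U : set (measurableTypeR R * Z)) : measurable U ->
  measurable [set w | (hits (Theta w) U #= `I_k)%card].
Proof.
move=> mU; have [mT _] := Theta_finite.
rewrite -[X in measurable X]setTI; apply: (mT measurableT [set th | (hits th U #= `I_k)%card]).
by apply: sub_gen_smallest; exists k, U.
Qed.

Lemma measurable_counting_measure (U : set (measurableTypeR R * Z)) :
  measurable U -> measurable_fun setT (fun w => counting_measure (Theta w) U).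
Proof.
move=> mU; apply: (@measurability _ _ Om (\bar R) setT _ (@ErealGenOInfty.G R)).
  exact: ErealGenOInfty.measurableE.
move=> _ [_ [x ->] <-].
(* The count exceeds x exactly when it is none of the natural numbers k <= x; this covers the value
   +oo as well. *)
rewrite (_ : _ `&` _ = ~` \bigcup_(k in [set k : nat | k%:R <= x])
    [set w | (hits (Theta w) U #= `I_k)%card]).
  by apply: measurableC; apply: bigcup_measurable => k _; exact: measurable_hits.
apply/seteqP; split => w /=.
  move=> [_]; rewrite in_itv/= andbT /counting_measure /counting => xH [k kx Hk].
  move: xH; rewrite asboolT; last by exists k.
  by rewrite (card_fset_set Hk) lte_fin ltNge kx.
move=> nk; split => //; rewrite in_itv/= andbT /counting_measure /counting.
case: asboolP => [[k Hk]|_]; last by rewrite ltry.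
rewrite (card_fset_set Hk) lte_fin ltNge; apply/negP => kx; apply: nk.
by exists k.
Qed.

Lemma finite_hits_ae (t : R) : 0 < t ->
  {ae P, forall w, finite_set (hits (Theta w) (`]0, t] `*` [set: Z]))}.
Proof.
move=> t0; set U := _ `*` _.
have mU : measurable (U : set (measurableTypeR R * Z)) by exact: measurableX.
have mN := measurable_counting_measure mU.
have [_ /(_ _ t0) intoo] := Theta_finite.
have int : P.-integrable setT (fun w => counting_measure (Theta w) U).
  apply/integrableP; split => //.
  by under eq_integral do rewrite gee0_abs ?measure_ge0//.
have := integrable_ae measurableT int.
apply: negligibleS => w /= nf H; apply: nf; have := H I.
by rewrite /counting_measure /counting; case: asboolP.
Qed.

(** If the hitting times stayed below some t, an infinite domain would lie in a bounded interval,
    where the finite expected count allows only finitely many hits almost surely. *)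
Lemma hitting_times_unbounded : {ae P, forall w,
  [/\ point_dom (Theta w) = range (fun m => alpha m.+1 w),
      forall m, alpha m w < alpha m.+1 w &
      forall t : R, exists m, t < alpha m w]}.
Proof.
have [_ _ _ al_ae] := alphaP.
have fin_ae : {ae P, forall w, forall n : nat,
    finite_set (hits (Theta w) (`]0, n.+1%:R] `*` [set: Z]))}.
  by apply: ae_foralln => n; exact: finite_hits_ae.
apply: filterS3 fin_ae al_ae Theta_infinite => w fin [dom lt] inf; split => // t.
apply: contrapT => nt; apply: inf.
have [n tn] : exists n : nat, t < n.+1%:R.
  exists (Num.truncn `|t|); apply: le_lt_trans (ler_norm t) _.
  by have /andP[] := truncn_itv (normr_ge0 t).
have al0 : alpha 0%N w = 0 by have [] := alphaP.
apply: sub_finite_set (fin n) => s; rewrite dom => -[m _ <-].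
apply/(@hits_mark _ _ _ _ (fun m => alpha m w) dom); exists m => //; split => //=.
rewrite in_itv/= -al0 (@times_lt _ (fun m => alpha m w) lt 0 m.+1)//=.
apply: ltW; apply: le_lt_trans tn.
by rewrite leNgt; apply/negP => tm; apply: nt; exists m.+1.
Qed.

Lemma card_eq_II0 T (H : set T) : (H #= `I_0)%card <-> H = set0.
Proof. by rewrite II0 card_eq0; split => /eqP. Qed.

Lemma measurable_mark m :
  measurable_fun setT (fun w => mark (Theta w) (fun k => alpha k w) m.+1).
Proof.
move=> _ B mB; rewrite setTI.
(* Almost surely, the mark of alpha m.+1 lies in B iff every interval
   ]q i, q j] containing alpha m.+1 contains a hit with mark in B. *)
pose q (n : nat) : rat := odflt 0 (unpickle n).
pose U (i j : nat) : set (measurableTypeR R * Z) := `]ratr (q i), ratr (q j)] `*` B.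
have mU i j : measurable (U i j) by exact: measurableX.
have mal : measurable_fun setT (alpha m.+1) by have [_ + _ _] := alphaP; exact.
pose G i j := [set w | alpha m.+1 w <= ratr (q i)] `|` [set w | ratr (q j) < alpha m.+1 w] `|`
  ~` [set w | (hits (Theta w) (U i j) #= `I_0)%card].
apply: (@complete_measurable_set _ _ _ P cP (\bigcap_i \bigcap_j G i j)).
  apply: bigcapT_measurable => i; apply: bigcapT_measurable => j.
  apply: measurableU; last by apply: measurableC; exact: measurable_hits.
  apply: measurableU.
    rewrite (_ : [set w | _] = setT `&` alpha m.+1 @^-1` `]-oo, ratr (q i)]).
      exact: mal.
    by rewrite setTI; apply/seteqP; split => w /=; rewrite in_itv.
  rewrite (_ : [set w | _] = setT `&` alpha m.+1 @^-1` `]ratr (q j), +oo[).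
    exact: mal.
  by rewrite setTI; apply/seteqP; split => w /=; rewrite in_itv/= andbT.
apply: filterS hitting_times_unbounded => w [dom lt _].
have HM := @hits_mark _ _ _ (Theta w) (fun m => alpha m w) dom.
split; last first.
  move=> Bm i _ j _; rewrite /G /=.
  have [aq|qa] := leP (alpha m.+1 w) (ratr (q i)); first by left; left.
  have [aq'|qa'] := ltP (ratr (q j)) (alpha m.+1 w); first by left; right.
  right => /card_eq_II0 H; have : hits (Theta w) (U i j) (alpha m.+1 w).
    by apply/HM; exists m => //; split => //=; rewrite in_itv/= qa qa'.
  by rewrite H.
move=> GG.
(* The rationals r1 and r2 isolate [alpha m.+1]: no other hitting time lies in []r1, r2]], so the
   hit found there carries the mark in question. *)
have [r1] := rat_in_itvoo (lt m); rewrite in_itv/= => /andP[r1l r1r].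
have [r2] := rat_in_itvoo (lt m.+1); rewrite in_itv/= => /andP[r2l r2r].
have qP (r : rat) : q (pickle r) = r by rewrite /q pickleK.
have := GG (pickle r1) I (pickle r2) I; rewrite /G /= !qP => -[[]|].
- by rewrite leNgt r1r.
- by rewrite ltNge ltW.
move=> nH; have /set0P[s Hs] : hits (Theta w) (U (pickle r1) (pickle r2)) != set0.
  by apply/eqP => H; apply: nH; rewrite H; apply/card_eq_II0.
have [k _] := (HM _ _).1 Hs.
rewrite /U /= in_itv/= !qP => -[/andP[a1 a2] Bk].
suff <- : k = m by [].
have k1 : (m < k.+1)%N by apply: (@times_lt_inv _ (fun m => alpha m w) lt); exact: lt_trans a1.
have k2 : (k.+1 < m.+2)%N by apply: (@times_lt_inv _ (fun m => alpha m w) lt); exact: le_lt_trans r2r.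
by apply/eqP; rewrite eqn_leq; apply/andP; split; [exact: k2|exact: k1].
Qed.

End point_process_times.

(** * The pathwise problem *)

Lemma integrable_concat (R : realType) (h : R -> R) (a b c : R)
    (mu := @lebesgue_measure R) : a <= b -> b <= c ->
  mu.-integrable `]a, b[ (EFin \o h) -> mu.-integrable `]b, c[ (EFin \o h) ->
  mu.-integrable `]a, c[ (EFin \o h) /\
  \int[mu]_(s in `]a, c[) h s = \int[mu]_(s in `]a, b[) h s + \int[mu]_(s in `]b, c[) h s.
Proof.
have e0 (x : R) : `]x, x[%classic = set0 :> set R.
  by apply/seteqP; split => y //=; rewrite in_itv/= => /andP[? ?]; lra.
move=> ab bc i1 i2.
have [eab|nab] := eqVneq a b; first by rewrite eab e0 Rintegral_set0 add0r.
have [ebc|nbc] := eqVneq b c; first by rewrite -ebc e0 Rintegral_set0 addr0.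
have {nab}ab : a < b by rewrite lt_neqAle nab.
have {nbc}bc : b < c by rewrite lt_neqAle nbc.
pose B1 : set (measurableTypeR R) := `]a, b[%classic.
pose B2 : set (measurableTypeR R) := `]b, c[%classic.
pose B : set (measurableTypeR R) := `]a, c[%classic.
have mB1 : measurable B1 by exact: measurable_itv.
have mB2 : measurable B2 by exact: measurable_itv.
have mB : measurable B by exact: measurable_itv.
have mb : measurable ([set b] : set (measurableTypeR R)) by exact: measurable_real_set1.
have dis : [disjoint B1 & B2]%classic.
  apply/disj_set2P/seteqP; split => y //=.
  by rewrite /B1 /B2 /= !in_itv/= => -[/andP[? ?] /andP[? ?]]; lra.
have [/integrableP[m1 f1] /integrableP[m2 f2]] := (i1, i2).
have iU : mu.-integrable (B1 `|` B2) (EFin \o h).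
  apply/integrableP; split; first exact/measurable_funU.
  rewrite ge0_integral_setU//; first exact: lte_add_pinfty.
  by apply: measurableT_comp => //; apply/measurable_funU.
have BE : B `\` [set b] = B1 `|` B2.
  apply/seteqP; split => y; rewrite /B /B1 /B2 /= !in_itv/=.
    move=> [/andP[ay yc] /eqP yb]; case: (ltgtP y b) yb => // yb _; [left|right].
      by rewrite ay.
    by rewrite yc.
  by move=> [/andP[? ?]|/andP[? ?]]; (split; [apply/andP; split; lra|apply/eqP; lra]).
have mh : measurable_fun B (EFin \o h).
  have -> : B = (B1 `|` B2) `|` [set b].
    rewrite -BE setUC setDUK// => _ ->; rewrite /B/= in_itv/=; apply/andP; split; lra.
  apply/measurable_funU => //; first exact: measurableU.
  by split; [case/integrableP : iU|exact: measurable_fun_set1].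
have b0 : mu [set b] = 0 by exact: lebesgue_measure_set1.
have iB : mu.-integrable B (EFin \o h).
  by apply/(negligible_integrable mb mB mh b0); rewrite BE.
split => //.
by rewrite -Rintegral_setU// -BE /Rintegral (negligible_integral mb mB iB b0).
Qed.

Lemma measurable_continuous_borel (R : realType) (V : normedModType R) (f : V -> R) :
  continuous (f : V -> R^o) -> measurable_fun setT (f : borelType V -> R).
Proof.
move=> cf; apply: (@measurability _ _ (borelType V) R setT _ (@RGenOInfty.G R)).
  exact: RGenOInfty.measurableE.
move=> _ [_ [x ->] <-].
rewrite setTI; apply: sub_gen_smallest.
rewrite (_ : _ @^-1` _ = f @^-1` [set y | x < y]); last first.
  by apply/seteqP; split => s /=; rewrite in_itv/= andbT.
by apply: open_comp => [v _|]; [exact: cf|exact: open_gt].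
Qed.

Section pathwise.
Context {R : realType} {d d' : measure_display} {Om : measurableType d}.
Context {Z : measurableType d'} {V : completeNormedModType R}.
Notation mu := (@lebesgue_measure R).
Variables (A : V -> set V) (T : R -> V -> V) (A0 : V -> V).
Hypothesis accA : accretive A.
Hypothesis denseA : densely_defined A.
Hypothesis TP : associated_semigroup A T.
Hypothesis T_domain : domain_invariant A T.
Hypothesis A0P : infinitesimal_generator A T A0.
Hypothesis sepV : separable V.
Variables (U : set V) (Vstar : set {linear V -> R^o}).
Hypothesis U_linear : forall (a : R) u v, U u -> U v -> U (a *: u + v).
Hypothesis Vstar_dual : Vstar `<=` topological_dual.
Hypothesis Vstar_sep : separates_points Vstar.
Hypothesis U_invariant : semigroup_invariant T U.
Hypothesis U_integrable : forall (t : R) u (Psi : {linear V -> R^o}),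
    0 < t -> U u -> Vstar Psi ->
    mu.-integrable `]0, t[ (fun s => (Psi (A0 (T s u)))%:E).
Variables (Theta : Om -> point_function R Z) (alpha : nat -> Om -> R).
Variables (x : Om -> V) (eta : R -> Z -> Om -> V).
Hypothesis eta_meas : measurable_coefficient eta.
Variable w : Om.
Let al m := alpha m w.
Hypothesis al0 : al 0 = 0.
Hypothesis dom_theta : point_dom (Theta w) = range (fun m => al m.+1).
Hypothesis al_lt : forall m, al m < al m.+1.
Hypothesis al_unbounded : forall t, exists m, t < al m.
Hypothesis xU : U (x w).
Hypothesis etaU : forall (t : R) (z : Z), 0 < t -> U (eta t z w).
Let xm m := post_jump T Theta alpha x eta m w.
Let X t := generated_process T Theta alpha x eta t w.

Let al_ge0 m : 0 <= al m.
Proof. by rewrite -al0; exact: times_le. Qed.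

Let jumpE m : jump Theta alpha eta m.+1 w = eta (al m.+1) (mark (Theta w) al m.+1) w.
Proof. by rewrite /jump -/(al m.+1) (theta_mark dom_theta). Qed.

(** The restarted states stay in the subspace, so the integrability hypothesis applies to every
    piece of the path. *)
Lemma post_jumpU m : U (xm m).
Proof.
elim: m => [//|m IH]; rewrite /xm/= -[T _ _]scale1r; apply: U_linear.
  by apply: U_invariant => //; rewrite subr_ge0 ltW// al_lt.
by rewrite jumpE; apply: etaU; rewrite -al0 times_lt.
Qed.

Lemma generated_processE m t : al m <= t < al m.+1 -> X t = T (t - al m) (xm m).
Proof.
move=> mt; rewrite /X /generated_process.
set f := (fun m => _); have fm : f m = T (t - al m) (xm m).
  rewrite /f indicE mem_set/= ?in_itv//= scale1r max_l// subr_ge0.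
  by case/andP : mt.
have fk k : k != m -> f k = 0.
  move=> km; rewrite /f indicE memNset ?scale0r//= in_itv/= => kt.
  by move/eqP : km; apply; exact: times_bracket_uniq kt mt.
apply/cvg_lim; first exact: norm_hausdorff.
apply: cvg_near_cst; exists m.+1 => // n /= mn.
rewrite /series/= (bigD1_seq m) ?iota_uniq ?mem_index_iota//= fm big1 ?addr0//.
Qed.

Let bracket t : 0 <= t -> exists m, al m <= t < al m.+1.
Proof. by move=> t0; apply: times_bracket => //; rewrite al0. Qed.

Let bracket_left t : 0 < t -> exists m, al m < t <= al m.+1.
Proof.
move=> t0; have [m /andP[mt tm]] := bracket (ltW t0).
have [tE|tn] := eqVneq t (al m); last first.
  by exists m; rewrite (ltW tm) lt_neqAle eq_sym tn mt.
case: m {mt tm} tE => [|m] tE; first by move: t0; rewrite tE al0 ltxx.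
by exists m; rewrite tE al_lt lexx.
Qed.

Let cont_piece m : continuous (fun t => T (Num.max (t - al m) 0) (xm m)).
Proof.
move=> t.
apply: (@continuous_comp _ _ _ (fun t : R => t - al m) (fun s => T (Num.max s 0) (xm m))).
  by apply: cvgB; [exact: cvg_id|exact: cvg_cst].
exact: (@semigroup_continuous _ _ _ _ accA denseA TP).
Qed.

Lemma generated_process_cadlag : cadlag X.
Proof.
split => t t0.
  have [m /andP[mt tm]] := bracket t0.
  have -> : X t = T (Num.max (t - al m) 0) (xm m).
    by rewrite (@generated_processE m) ?mt// max_l// subr_ge0.
  have := @cont_piece m t => /cvg_at_right_filter; apply: cvg_trans.
  apply: near_eq_cvg; near=> s.
  have ts : t < s by near: s; exact: nbhs_right_gt.
  have sm : s < al m.+1 by near: s; exact: nbhs_right_lt.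
  have ms : al m <= s by rewrite (le_trans mt) ?ltW.
  by rewrite (@generated_processE m) ?ms// max_l// subr_ge0.
have [m /andP[mt tm]] := bracket_left t0.
apply/cvg_ex; exists (T (Num.max (t - al m) 0) (xm m)).
have := @cont_piece m t => /cvg_at_left_filter; apply: cvg_trans.
apply: near_eq_cvg; near=> s.
have st : s < t by near: s; exact: nbhs_left_lt.
have ms : al m <= s by near: s; exact: nbhs_left_ge.
by rewrite (@generated_processE m) ?ms ?(lt_le_trans st)// max_l// subr_ge0.
Unshelve. all: by end_near. Qed.

Lemma generated_process_domain t : 0 < t -> (forall m, t != al m.+1) -> op_domain A (X t).
Proof.
move=> t0 nt; have [m /andP[mt tm]] := bracket (ltW t0).
rewrite (@generated_processE m) ?mt//; apply: T_domain.
rewrite subr_gt0 lt_neqAle mt andbT; case: m {mt tm} => [|m]; first by rewrite al0 lt_eqF.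
by rewrite eq_sym.
Qed.

Lemma generated_process_W11 m a b : al m < a -> a < b -> b < al m.+1 -> W11 a b X.
Proof.
move=> ma ab bm.
apply: (@W11_ext _ _ (fun t => T (t - al m) (xm m))).
  move=> t /andP[at_ tb]; rewrite (@generated_processE m)//.
  by apply/andP; split; lra.
exact: (orbit_W11 accA denseA TP T_domain A0P).
Qed.

(** The endpoint t = [al m.+1] is included, so the formula contains the value [T (t - al m) (xm m)]
    of the current piece, the left limit there, and not [X t]. *)
Lemma generated_process_piece m t (Psi : {linear V -> R^o}) : al m < t -> t <= al m.+1 ->
  Vstar Psi ->
  mu.-integrable `]al m, t[ (fun s => (Psi (A0 (X s)))%:E) /\
  \int[mu]_(s in `]al m, t[) Psi (A0 (X s)) = Psi (xm m) - Psi (T (t - al m) (xm m)).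
Proof.
move=> mt tm VPsi; have r0 : 0 < t - al m by rewrite subr_gt0.
have int r : 0 < r -> mu.-integrable `]0, r[ (fun s => (Psi (A0 (T s (xm m))))%:E).
  by move=> r1; apply: U_integrable => //; exact: post_jumpU.
have XE s : s \in `]al m, t[%classic -> A0 (X s) = A0 (T (s - al m) (xm m)).
  rewrite inE/= in_itv/= => /andP[ms st].
  by rewrite (@generated_processE m)// (ltW ms) (lt_le_trans st).
have := @integrable_shift _ (al m) (fun s => Psi (A0 (T s (xm m)))) _ (int _ r0).
have := @Rintegral_shift _ (al m) (fun s => Psi (A0 (T s (xm m)))) _ (int _ r0).
rewrite addrC subrK => I1 I2; split.
  by apply: eq_integrable I2 => // s sI; rewrite XE.
transitivity (\int[mu]_(s in `]al m, t[) Psi (A0 (T (s - al m) (xm m)))).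
  by apply: eq_Rintegral => s sI; rewrite XE.
rewrite I1; have := orbit_integral accA denseA TP T_domain A0P (Vstar_dual VPsi) r0 int.
lra.
Qed.

(** Telescoping: the tested equation gains nothing along a piece, and at [al n.+1] the passage from
    the left limit to [xm n.+1] adds the jump. *)
Lemma generated_process_increments m (Psi : {linear V -> R^o}) : Vstar Psi ->
  forall t, al m <= t < al m.+1 ->
  mu.-integrable `]0, t[ (fun s => (Psi (A0 (X s)))%:E) /\
  Psi (X t) - Psi (x w) + \int[mu]_(s in `]0, t[) Psi (A0 (X s)) =
    \sum_(k < m) Psi (eta (al k.+1) (mark (Theta w) al k.+1) w).
Proof.
move=> VPsi.
have e0 (y : R) : `]y, y[%classic = set0 :> set R.
  by apply/seteqP; split => z //=; rewrite in_itv/= => /andP[? ?]; lra.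
have step n : mu.-integrable `]0, al n[ (fun s => (Psi (A0 (X s)))%:E) ->
  Psi (xm n) - Psi (x w) + \int[mu]_(s in `]0, al n[) Psi (A0 (X s)) =
    \sum_(k < n) Psi (eta (al k.+1) (mark (Theta w) al k.+1) w) ->
  forall t, al n <= t <= al n.+1 ->
  mu.-integrable `]0, t[ (fun s => (Psi (A0 (X s)))%:E) /\
  Psi (T (t - al n) (xm n)) - Psi (x w) + \int[mu]_(s in `]0, t[) Psi (A0 (X s)) =
    \sum_(k < n) Psi (eta (al k.+1) (mark (Theta w) al k.+1) w).
  move=> I1 I2 t /andP[nt tn].
  have [->|ntn] := eqVneq t (al n); first by rewrite subrr (semigroup0 TP).
  have {}nt : al n < t by rewrite lt_neqAle eq_sym ntn.
  have [J1 J2] := generated_process_piece nt tn VPsi.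
  have [K1 K2] := integrable_concat (al_ge0 n) (ltW nt) I1 J1.
  by split => //; rewrite K2 J2; lra.
have base n : mu.-integrable `]0, al n[ (fun s => (Psi (A0 (X s)))%:E) /\
  Psi (xm n) - Psi (x w) + \int[mu]_(s in `]0, al n[) Psi (A0 (X s)) =
    \sum_(k < n) Psi (eta (al k.+1) (mark (Theta w) al k.+1) w).
  elim: n => [|n [I1 I2]].
    rewrite al0 e0 Rintegral_set0 addr0 big_ord0 subrr; split => //.
    exact: integrable_set0.
  have [|J1 J2] := step n I1 I2 (al n.+1); first by rewrite lexx ltW// al_lt.
  split => //; rewrite big_ord_recr/= -J2 {1}/xm/= linearD/= jumpE; ring.
move=> t /andP[mt tm]; have [I1 I2] := base m.
have [|J1 J2] := step m I1 I2 t; first by rewrite mt ltW.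
by split => //; rewrite (@generated_processE m) ?mt.
Qed.

Lemma measurable_coefficient_path (Psi : {linear V -> R^o}) (t : R) : Vstar Psi ->
  measurable_fun (`]0, t] `*` [set: Z] : set (measurableTypeR R * Z))
    (fun p => Psi (eta p.1 p.2 w)).
Proof.
move=> VPsi.
have mPsi := measurable_continuous_borel (Vstar_dual VPsi).
apply: (measurableT_comp mPsi).
pose D : set (measurableTypeR R * Z * Om) := `]0, +oo[ `*` [set: Z] `*` [set: Om].
have mD : measurable D by apply: measurableX => //; exact: measurableX.
have sub : [set (p, w) | p in (`]0, t] `*` [set: Z] : set (measurableTypeR R * Z))] `<=` D.
  move=> _ [[s z] [+ _] <-]; rewrite /= in_itv/= => /andP[s0 _].
  by split => //; split => //=; rewrite in_itv/= s0.
have mw : measurable_fun (`]0, t] `*` [set: Z] : set (measurableTypeR R * Z))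
    (fun p : measurableTypeR R * Z => (p, w)).
  by apply: measurable_funTS; exact: pair2_measurable.
exact: (measurable_comp mD sub eta_meas mw).
Qed.

Lemma jump_integral (Psi : {linear V -> R^o}) m t : Vstar Psi -> al m <= t < al m.+1 ->
  \int[counting_measure (Theta w)]_(p in `]0%R, t] `*` [set: Z]) Psi (eta p.1 p.2 w) =
  \sum_(k < m) Psi (eta (al k.+1) (mark (Theta w) al k.+1) w).
Proof.
move=> VPsi mt.
by rewrite (Rintegral_counting al0 al_lt dom_theta mt (@measurable_coefficient_path Psi t VPsi)).
Qed.

(* The almost sure part of [strong_solution] at the fixed sample point w. *)
Definition solution_path (Y : R -> V) :=
  [/\ Y 0 = x w,
      cadlag Y,
      forall t : R, 0 < t -> (forall m, t != al m.+1) -> op_domain A (Y t) &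
      forall m a b, al m < a -> a < b -> b < al m.+1 -> W11 a b Y] /\
  forall (t : R) (Psi : {linear V -> R^o}), 0 < t -> Vstar Psi ->
    mu.-integrable `]0, t[ (fun s => (Psi (A0 (Y s)))%:E) /\
    Psi (Y t - x w) + \int[mu]_(s in `]0, t[) Psi (A0 (Y s)) =
    \int[counting_measure (Theta w)]_(p in `]0%R, t] `*` [set: Z]) Psi (eta p.1 p.2 w).

Lemma generated_process_solution : solution_path X.
Proof.
split; first split.
- have m0 : al 0 <= 0 < al 1 by rewrite al0 lexx -{1}al0 al_lt.
  by rewrite (generated_processE m0) al0 subrr (semigroup0 TP).
- exact: generated_process_cadlag.
- exact: generated_process_domain.
- exact: generated_process_W11.
move=> t Psi t0 VPsi; have [m mt] := bracket (ltW t0).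
have [I1 I2] := generated_process_increments VPsi mt.
by split => //; rewrite (jump_integral VPsi mt) -I2 linearB.
Qed.

Lemma solution_path_piece Y m : solution_path Y -> Vstar !=set0 ->
  forall t, al m <= t < al m.+1 -> Y t = T (t - al m) (Y (al m)).
Proof.
move=> [[Y0 [rcY _] DY WY] wY] V0.
apply: (orbit_unique_right accA denseA TP); first by apply: rcY; exact: al_ge0.
move=> a b ma ab bm.
have [<-|nab] := eqVneq a b; first by rewrite subrr (semigroup0 TP).
have {nab}ab : a < b by rewrite lt_neqAle nab.
have [psi [Vpsi psi0]] := countable_separating sepV Vstar_dual Vstar_sep V0.
have a0 : 0 < a by apply: le_lt_trans ma; exact: al_ge0.
(* The counting integral takes the same value at a and at t, so the difference of the two equations
   contains no jump. *)
have incr Psi : Vstar Psi -> forall t, a < t < b ->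
    mu.-integrable `]a, t[ (fun s => (Psi (A0 (Y s)))%:E) /\
    Psi (Y t) - Psi (Y a) = - \int[mu]_(s in `]a, t[) Psi (A0 (Y s)).
  move=> VPsi t /andP[at_ tb].
  have t0 : 0 < t by lra.
  have [I1 I2] := wY t Psi t0 VPsi; have [J1 J2] := wY a Psi a0 VPsi.
  have K : mu.-integrable `]a, t[ (fun s => (Psi (A0 (Y s)))%:E).
    apply: integrableS I1 => // s /=; rewrite !in_itv/= => /andP[as_ ->].
    by rewrite andbT (lt_trans a0).
  have [_ L] := integrable_concat (ltW a0) (ltW at_) J1 K.
  split => //; move: I2 J2; rewrite L !linearB/=.
  rewrite (@jump_integral _ m t)//; last by apply/andP; split; lra.
  rewrite (@jump_integral _ m a)//; last by apply/andP; split; lra.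
  by move: (\sum_(_ < _) _) => S; lra.
have b0 : 0 < b by lra.
have int i j : mu.-integrable `]a, b[ (EFin \o (psi i j \o (A0 \o Y))).
  have [I1 _] := wY b _ b0 (Vpsi i j).
  apply: integrableS I1 => // s /=; rewrite !in_itv/= => /andP[as_ ->].
  by rewrite andbT (lt_trans a0).
have inc i j t : a < t < b -> psi i j (Y t) - psi i j (Y a) =
    - \int[mu]_(s in `]a, t[) psi i j ((A0 \o Y) s).
  by move=> tab; have [] := incr _ (Vpsi i j) t tab.
have cpsi i j : continuous (psi i j) by exact: (Vstar_dual (Vpsi i j)).
have [E nE EP] := derivative_of_weak_primitive ab (WY m a b ma ab bm) cpsi psi0 int inc.
have acY : absolutely_continuous_on a b Y by have [] := WY m a b ma ab bm.
(* Membership in D(A) is granted off the hitting times, and none lies strictly between [al m] and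
   [al m.+1]. *)
have DYab t : a <= t < b -> op_domain A (Y t).
  move=> /andP[at_ tb]; apply: DY; first by lra.
  move=> k; apply/eqP => tk.
  have mk : (m < k.+1)%N by apply: (times_lt_inv al_lt); rewrite -tk; lra.
  have km : (k.+1 < m.+1)%N by apply: (times_lt_inv al_lt); rewrite -tk; lra.
  by move: mk; rewrite ltnNge -ltnS km.
exact: (orbit_unique accA denseA TP A0P (ltW ab) acY DYab nE EP).
Qed.

Lemma solution_path_unique Y1 Y2 : solution_path Y1 -> solution_path Y2 ->
  forall t, 0 <= t -> Y1 t = Y2 t.
Proof.
move=> s1 s2.
(* An empty V* separates points only when V is trivial. *)
have [V0|V0] := pselect (Vstar !=set0); last first.
  have z (v : V) : v = 0 by apply: Vstar_sep => Psi VPsi; exfalso; apply: V0; exists Psi.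
  by move=> t _; rewrite (z (Y1 t)) (z (Y2 t)).
have piece m : Y1 (al m) = Y2 (al m) -> forall t, al m <= t < al m.+1 -> Y1 t = Y2 t.
  by move=> e t mt; rewrite (solution_path_piece s1 V0 mt) (solution_path_piece s2 V0 mt) e.
have upto m : forall t, 0 <= t <= al m -> Y1 t = Y2 t.
  elim: m => [t /andP[t0 t1]|m IH t /andP[t0 tm]].
    have -> : t = 0 by rewrite al0 in t1; lra.
    by have [[-> _ _ _] _] := s1; have [[-> _ _ _] _] := s2.
  have below s : 0 <= s < al m.+1 -> Y1 s = Y2 s.
    move=> /andP[s0 sm]; have [sm'|ms] := leP s (al m); first by apply: IH; rewrite s0.
    apply: (@piece m); last by rewrite (ltW ms).
    by apply: IH; rewrite al_ge0 lexx.
  have [tE|tn] := eqVneq t (al m.+1); last first.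
    by apply: below; rewrite t0 lt_neqAle tn.
  have tp : 0 < t by rewrite tE -al0 times_lt.
  apply/eqP; rewrite -subr_eq0; apply/eqP; apply: Vstar_sep => Psi VPsi.
  have [_ w1] := s1; have [_ w2] := s2.
  have [_ e1] := w1 t Psi tp VPsi; have [_ e2] := w2 t Psi tp VPsi.
  (* The open interval []0, t[] involves only times before t, where the two paths already agree. *)
  have I12 : \int[mu]_(s in `]0, t[) Psi (A0 (Y1 s)) = \int[mu]_(s in `]0, t[) Psi (A0 (Y2 s)).
    apply: eq_Rintegral => s; rewrite inE/= in_itv/= => /andP[s0 st].
    by rewrite below// (ltW s0) -tE.
  move: e1 e2; rewrite I12 => <-; rewrite !linearB/=; lra.
move=> t t0; have [m /andP[mt _]] := bracket t0.
have [k tk] := al_unbounded t.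
by apply: (upto k); rewrite t0 ltW.
Qed.

End pathwise.

(** * Measurability of the generated process *)

Section generated_process_measurable.
Context {R : realType} {d d' : measure_display} {Om : measurableType d}.
Context (P : probability Om R) {Z : measurableType d'} {V : completeNormedModType R}.
Hypothesis cP : measure_is_complete P.
Variables (Theta : Om -> point_function R Z) (alpha : nat -> Om -> R).
Hypothesis Theta_finite : finite_point_process P Theta.
Hypothesis alphaP : hitting_times P Theta alpha.
Hypothesis Theta_infinite : {ae P, forall w, infinite_set (point_dom (Theta w))}.
Variables (A : V -> set V) (T : R -> V -> V).
Hypothesis accA : accretive A.
Hypothesis denseA : densely_defined A.
Hypothesis TP : associated_semigroup A T.
Hypothesis sepV : separable V.
Variables (x : Om -> V) (eta : R -> Z -> Om -> V).
Hypothesis x_meas : measurable_fun [set: Om] (x : Om -> borelType V).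
Hypothesis eta_meas : measurable_coefficient eta.

Let malpha m : measurable_fun setT (alpha m).
Proof. by have [_ + _ _] := alphaP; exact. Qed.

Let T_cont t v : 0 <= t -> {for v, continuous (T t)}.
Proof.
move=> t0; apply/cvgrPdist_le => e e0; near=> u.
apply: le_trans (semigroup_contraction accA denseA TP _ _ t0) _.
by near: u; apply: cvgr_dist_le; [exact: cvg_id|].
Unshelve. all: by end_near. Qed.

Let T_meas d0 (S : measurableType d0) (r : S -> R) (y : S -> borelType V) :
  (forall s, 0 <= r s) -> measurable_fun setT r -> measurable_fun setT y ->
  measurable_fun setT (fun s => T (r s) (y s) : borelType V).
Proof.
move=> r0 mr my.
apply: (@measurable_semigroup_comp R V _ S setT measurableT sepV T r y) => //.
by move=> v; exact: (semigroup_continuous accA denseA TP).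
Qed.

Lemma measurable_jump m :
  measurable_fun setT (jump Theta alpha eta m.+1 : Om -> borelType V).
Proof.
have mm := measurable_mark cP Theta_finite alphaP Theta_infinite m.
pose D : set (measurableTypeR R * Z * Om) := `]0, +oo[ `*` [set: Z] `*` [set: Om].
have mD : measurable D by apply: measurableX => //; exact: measurableX.
pose g w : measurableTypeR R * Z * Om :=
  (alpha m.+1 w, mark (Theta w) (fun k => alpha k w) m.+1, w).
have mg : measurable_fun setT g.
  apply: measurable_fun_pair => //; apply: measurable_fun_pair => //.
  exact: malpha.
have sub : [set g w | w in [set: Om]] `<=` D.
  (* [alpha m.+1] is positive at every w, which keeps the image of g inside the domain on which eta
     is measurable. *)
  move=> _ [w _ <-]; split => //; split => //=; rewrite in_itv/= andbT.
  by have [_ _ + _] := alphaP; exact.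
(* Off the almost sure event [mark] and [jump] use different default values; completeness absorbs
   the difference. *)
apply: (complete_measurable_fun cP (measurable_comp mD sub eta_meas mg)).
apply: filterS (hitting_times_unbounded Theta_finite alphaP Theta_infinite).
move=> w [dom lt _]; rewrite /jump.
by rewrite (@theta_mark _ _ _ (Theta w) (fun k => alpha k w) dom m).
Qed.

Lemma measurable_post_jump m :
  measurable_fun setT (post_jump T Theta alpha x eta m : Om -> borelType V).
Proof.
elim: m => [//|m IH].
(* The truncation keeps the time nonnegative at every w and changes it only off the almost sure
   event where the times increase. *)
pose y w := T (Num.max (alpha m.+1 w - alpha m w) 0) (post_jump T Theta alpha x eta m w) +
  jump Theta alpha eta m.+1 w : borelType V.
have my : measurable_fun setT y.
  apply: (measurable_funD_borel measurableT sepV); last exact: measurable_jump.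
  apply: T_meas => //; first by move=> w; rewrite le_max lexx orbT.
  apply: measurable_maxr => //; apply: measurable_funB; exact: malpha.
apply: (complete_measurable_fun cP my).
apply: filterS (hitting_times_unbounded Theta_finite alphaP Theta_infinite).
by move=> w [_ lt _]; rewrite /y /= max_l// subr_ge0 ltW.
Qed.

Lemma measurable_generated_process :
  measurable_fun (`[0, +oo[ `*` [set: Om] : set (measurableTypeR R * Om))
    (fun p : measurableTypeR R * Om =>
       generated_process T Theta alpha x eta p.1 p.2 : borelType V).
Proof.
apply: measurable_funTS.
pose f_ m (p : measurableTypeR R * Om) : borelType V :=
  \1_(`[alpha m p.2, alpha m.+1 p.2[) p.1 *:
    T (Num.max (p.1 - alpha m p.2) 0) (post_jump T Theta alpha x eta m p.2).
have ma2 m : measurable_fun setT (fun p : measurableTypeR R * Om => alpha m p.2).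
  by apply: (measurableT_comp (malpha m)); exact: measurable_snd.
have mf m : measurable_fun setT (f_ m).
  pose g p : borelType V :=
    T (Num.max (p.1 - alpha m p.2) 0) (post_jump T Theta alpha x eta m p.2).
  (* The indicator factor becomes a case distinction, so scalar multiplication disappears from the
     measurability argument. *)
  rewrite (_ : f_ m = fun p => if (alpha m p.2 <= p.1) && (p.1 < alpha m.+1 p.2)
      then g p else (0 : V)); last first.
    apply/funext => p; rewrite /f_ indicE mem_setE in_itv/=.
    by case: ifP => _; rewrite ?scale1r ?scale0r.
  apply: measurable_fun_ifT => //.
  - apply: measurable_and; first by apply: measurable_fun_ler => //; exact: measurable_fst.
    by apply: measurable_fun_ltr => //; exact: measurable_fst.
  - apply: T_meas; first by move=> p; rewrite le_max lexx orbT.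
      apply: measurable_maxr => //; apply: measurable_funB => //; exact: measurable_fst.
    by apply: (measurableT_comp (measurable_post_jump m)); exact: measurable_snd.
have ms n := measurable_sum_borel measurableT sepV n mf.
exact: (measurable_fun_lim_borel measurableT sepV ms).
Qed.

End generated_process_measurable.

Theorem proposition0p3p11 (R : realType)
  (d : measure_display) (Omega : measurableType d) (P : probability Omega R)
  (P_complete : measure_is_complete P)
  (d' : measure_display) (Z : measurableType d')
  (Theta : Omega -> point_function R Z)
  (Theta_finite : finite_point_process P Theta)
  (Theta_infinite : {ae P, forall w, infinite_set (point_dom (Theta w))})
  (alpha : nat -> Omega -> R) (alphaP : hitting_times P Theta alpha)
  (V : completeNormedModType R) (V_separable : separable V)
  (A : V -> set V) (A_m_accretive : m_accretive A)
  (A_dense : densely_defined A)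
  (T : R -> V -> V) (TP : associated_semigroup A T)
  (T_domain : domain_invariant A T)
  (A0 : V -> V) (A0P : infinitesimal_generator A T A0)
  (U : set V) (U0 : U 0)
  (U_linear : forall (a : R) u v, U u -> U v -> U (a *: u + v))
  (Vstar : set {linear V -> R^o}) (Vstar_dual : Vstar `<=` topological_dual)
  (Vstar_sep : separates_points Vstar)
  (x : Omega -> V)
  (x_meas : measurable_fun [set: Omega] (x : Omega -> borelType V))
  (eta : R -> Z -> Omega -> V) (eta_meas : measurable_coefficient eta)
  (xU : {ae P, forall w, U (x w)})
  (etaU : {ae P, forall w, forall (t : R) (z : Z), 0 < t -> U (eta t z w)})
  (U_invariant : semigroup_invariant T U)
  (U_integrable : forall (t : R) u (Psi : {linear V -> R^o}),
    0 < t -> U u -> Vstar Psi ->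
    (@lebesgue_measure R).-integrable `]0, t[
      (fun s => (Psi (A0 (T s u)))%:E)) :
  let X := generated_process T Theta alpha x eta in
  strong_solution P A A0 Theta alpha x eta Vstar X /\
  forall Y : R -> Omega -> V,
    strong_solution P A A0 Theta alpha x eta Vstar Y ->
    {ae P, forall w, forall t : R, 0 <= t -> Y t w = X t w}.
Proof.
have accA := A_m_accretive.1.
have al0 w : alpha 0%N w = 0 by have [] := alphaP.
have good : {ae P, forall w,
    [/\ point_dom (Theta w) = range (fun m => alpha m.+1 w),
        forall m, alpha m w < alpha m.+1 w,
        forall t : R, exists m, t < alpha m w &
        U (x w) /\ forall (t : R) (z : Z), 0 < t -> U (eta t z w)]}.
  apply: filterS3 (hitting_times_unbounded Theta_finite alphaP Theta_infinite)
    xU etaU => w [dom lt unb] Ux Ueta.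
  by split.
have solX w : [/\ point_dom (Theta w) = range (fun m => alpha m.+1 w),
        forall m, alpha m w < alpha m.+1 w,
        forall t : R, exists m, t < alpha m w &
        U (x w) /\ forall (t : R) (z : Z), 0 < t -> U (eta t z w)] ->
    solution_path A A0 Vstar Theta alpha x eta w
      (generated_process T Theta alpha x eta ^~ w).
  move=> [dom lt unb [Ux Ueta]].
  exact: (generated_process_solution accA A_dense TP T_domain A0P V_separable
    U_linear Vstar_dual U_invariant U_integrable eta_meas (al0 w) dom lt unb Ux Ueta).
split.
  split.
    exact: (measurable_generated_process P_complete Theta_finite alphaP
      Theta_infinite accA A_dense TP V_separable x_meas eta_meas).
  exact: filterS good.
move=> Y [_ solY]; apply: filterS2 good solY => w good Yw t t0.
have Xw := solX w good; have [dom lt unb _] := good.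
exact: (solution_path_unique accA A_dense TP A0P V_separable Vstar_dual
  Vstar_sep eta_meas (al0 w) dom lt unb Yw Xw t0).
Qed.
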